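(* Let $j=2\pi\sqrt{-1}$, let $G$ be the solvable Lie group of all matrices $$g=\begin{pmatrix}1&c&0&e&f\\0&1&0&0&e\\0&0&e^{ja}&0&b\\0&0&0&1&a\\0&0&0&0&1\end{pmatrix},\qquad a,c,e,f\in\mathbf R,\ b\in\mathbf C,$$ and let $N$ be the normal subgroup in which $c=e=0$. Identify $\mathfrak g^*$ with $\mathbf R\times\mathbf C\times\mathbf R^3$ by letting $(p,z,r,s,t)$ denote the value at the identity of the 1-form $p\,da+\operatorname{Re}(\bar z\,db)-r\,dc-s\,de-t\,df$, and similarly $\mathfrak n^*$ with triples $(p,z,t)$. Then the coadjoint orbit $$X=G(0,1,0,0,1)=\{(p,e^{jq},r,s,1):p,q,r,s\in\mathbf R\}$$ of $G$, regarded as a hamiltonian $N$-space, is $N$-primary over the coadjoint orbit $U=\{(p,e^{jq},1):p,q\in\mathbf R\}$ of $N$, and $X$ does not split (neither trivially nor nontrivially).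
   Context: In the matrix, $e^{ja}$ denotes the exponential of $ja$, while the entry $e$ is a real parameter. A coadjoint orbit $X\subset\mathfrak g^*$ of $G$ is a symplectic manifold with its Kirillov-Kostant-Souriau 2-form; it is a hamiltonian $N$-space (symplectic manifold with symplectic $N$-action and equivariant moment map) with moment map $\Pi:X\to\mathfrak n^*$ the restriction to $X$ of the projection $\mathfrak g^*\to\mathfrak n^*$. It is $N$-primary over $U$ if $\Pi(X)=U$ is a single coadjoint orbit of $N$. A primary $N$-space over $U$ splits if it is isomorphic, as a hamiltonian $N$-space (via an $N$-equivariant diffeomorphism respecting 2-forms and moment maps), to a product $\bar U\times T$, where $\bar U$ is a homogeneous hamiltonian $N$-space whose moment map is a covering $\bar U\to U$, and $T$ is a symplectic manifold with trivial $N$-action and zero moment map; the product has 2-form $\omega_{\bar U}+\omega_T$, diagonal action and the sum of the moment maps. The splitting is trivial or nontrivial according as $\bar U\to U$ is bijective or not. *)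

(* Defs.v *)
From HB Require Import structures.
From mathcomp Require Import all_boot all_order all_algebra.
From mathcomp Require Import complex ring.
From mathcomp Require Import all_classical all_reals all_analysis.

Set Implicit Arguments.
Unset Strict Implicit.
Unset Printing Implicit Defensive.

Import Order.TTheory GRing.Theory Num.Theory numFieldNormedType.Exports.

Local Open Scope classical_set_scope.
Local Open Scope ring_scope.

Section Smooth.
Variable R : realType.

(* C^k and C^oo on [A], which is an open set wherever these are used. *)
Fixpoint Ck_on (V W : normedModType R) (k : nat) (A : set V) (f : V -> W) :
    Prop :=
  match k with
  | 0 => forall x, A x -> {for x, continuous f}
  | k'.+1 => (forall x, A x -> differentiable f x) /\
             (forall v : V, Ck_on k' A (fun x => 'd f x v))
  end.

Definition smooth_on (V W : normedModType R) (A : set V) (f : V -> W) : Prop :=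
  forall k, Ck_on k A f.

Record chart (T : topologicalType) (n : nat) := Chart {
  cdom : set T;
  cmap : T -> 'rV[R]_n;
  cinv : 'rV[R]_n -> T
}.

Definition cimg (T : topologicalType) (n : nat) (c : chart T n) :
  set 'rV[R]_n := cmap c @` cdom c.

(* The values of [cmap] off [cdom] and of [cinv] off [cimg] are junk. *)
Definition is_chart (T : topologicalType) (n : nat) (c : chart T n) : Prop :=
  [/\ open (cdom c),
      open (cimg c),
      (forall x, cdom c x -> cinv c (cmap c x) = x),
      (forall x, cdom c x -> {for x, continuous (cmap c)})
    & (forall y, cimg c y -> {for y, continuous (cinv c)})].

(* Raw data of a manifold; the axioms are in [is_manifold]. *)
Record charted := Charted {
  carrier :> topologicalType;
  mdim : nat;
  mindex : Type;
  mchart : mindex -> chart carrier mdim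
}.

Definition is_manifold (M : charted) : Prop :=
  [/\ hausdorff_space M,
      @second_countable M,
      (forall i, is_chart (@mchart M i)),
      (forall x : M, exists i, cdom (@mchart M i) x)
    & (forall i j, let ci := @mchart M i in let cj := @mchart M j in
         smooth_on (cmap ci @` (cdom ci `&` cdom cj)) (cmap cj \o cinv ci))].

Definition smooth (M N : charted) (f : M -> N) : Prop :=
  continuous f /\
  (forall i j, let ci := @mchart M i in let cj := @mchart N j in
     smooth_on (cmap ci @` (cdom ci `&` f @^-1` cdom cj))
               (cmap cj \o f \o cinv ci)).

(* The tangent map of [f] at [x], read in the charts [i] at [x] and [j] at
   [f x]; tangent vectors are represented by their components in a chart. *)
Definition tmap (M N : charted) (f : M -> N) (i : mindex M) (j : mindex N)
    (x : M) : 'rV[R]_(mdim M) -> 'rV[R]_(mdim N) :=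
  'd (cmap (mchart j) \o f \o cinv (mchart i)) (cmap (mchart i) x).

Definition vec_mfd (n : nat) : charted :=
  @Charted 'rV[R]_n n unit (fun _ => Chart setT id id).

Definition prod_chart (S T : topologicalType) (m n : nat) (c : chart S m)
    (d : chart T n) : chart (S * T)%type (m + n) :=
  Chart (cdom c `*` cdom d)
        (fun z => row_mx (cmap c z.1) (cmap d z.2))
        (fun v => (cinv c (lsubmx v), cinv d (rsubmx v))).

Definition prod_mfd (M N : charted) : charted :=
  @Charted (M * N)%type (mdim M + mdim N) (mindex M * mindex N)%type
    (fun ij => prod_chart (mchart ij.1) (mchart ij.2)).

(* The charts of [S], with the subspace topology, as an [n]-dimensional
   embedded submanifold of R^d. *)
Definition is_subchart (d n : nat) (S : set 'rV[R]_d) (c : chart S n) : Prop :=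
  [/\ is_chart c,
      smooth_on (cimg c) (fun y => set_val (cinv c y) : 'rV[R]_d)
    & (forall x : S, cdom c x ->
         exists (O : set 'rV[R]_d) (F : 'rV[R]_d -> 'rV[R]_n),
         [/\ open O, O (set_val x), smooth_on O F &
             forall y : S, cdom c y -> O (set_val y) ->
               cmap c y = F (set_val y)])].

Definition sub_mfd (d n : nat) (S : set 'rV[R]_d) : charted :=
  @Charted S n {c : chart S n | is_subchart c} (fun c => sval c).

(* [w i x] is the matrix of the form at [x] in the chart [i]. *)
Definition form2 (M : charted) : Type := mindex M -> M -> 'M[R]_(mdim M).

Definition form_eval (M : charted) (w : form2 M) (i : mindex M) (x : M)
    (u v : 'rV[R]_(mdim M)) : R := (u *m w i x *m v^T) 0 0.

Definition is_pullback (M N : charted) (f : M -> N) (wN : form2 N)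
    (wM : form2 M) : Prop :=
  forall i j x, cdom (mchart i) x -> cdom (mchart j) (f x) ->
  forall u v, form_eval wN j (f x) (tmap f i j x u) (tmap f i j x v)
            = form_eval wM i x u v.

(* The second condition is the transformation rule between charts. *)
Definition is_form2 (M : charted) (w : form2 M) : Prop :=
  [/\ (forall i x, cdom (mchart i) x -> (w i x)^T = - w i x),
      is_pullback id w w
    & (forall i, smooth_on (cimg (mchart i)) (w i \o cinv (mchart i)))].

Definition is_closed_form (M : charted) (w : form2 M) : Prop :=
  forall i y, cimg (mchart i) y ->
  let dw u := 'd (w i \o cinv (mchart i)) y u in
  forall u v s : 'rV[R]_(mdim M),
    (v *m dw u *m s^T + s *m dw v *m u^T + u *m dw s *m v^T) 0 0 = 0.

Definition is_symplectic (M : charted) (w : form2 M) : Prop :=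
  [/\ is_form2 w,
      is_closed_form w
    & (forall i x, cdom (mchart i) x ->
         forall u, (forall v, form_eval w i x u v = 0) -> u = 0)].

(* [lg_chart] is a chart at the identity; it serves to identify the Lie
   algebra T_1 G with row vectors. *)
Record lgroup := LGroup {
  lg_mfd :> charted;
  lg_one : lg_mfd;
  lg_mul : lg_mfd -> lg_mfd -> lg_mfd;
  lg_inv : lg_mfd -> lg_mfd;
  lg_chart : mindex lg_mfd
}.

Definition is_lie_group (G : lgroup) : Prop :=
  [/\ is_manifold G,
      [/\ associative (@lg_mul G),
          left_id (lg_one G) (@lg_mul G)
        & left_inverse (lg_one G) (@lg_inv G) (@lg_mul G)],
      @smooth (prod_mfd G G) G (fun z => lg_mul z.1 z.2),
      smooth (@lg_inv G)
    & cdom (mchart (lg_chart G)) (lg_one G)].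

Definition is_subgroup (G : lgroup) (H : set G) : Prop :=
  [/\ H (lg_one G),
      (forall x y, H x -> H y -> H (lg_mul x y))
    & (forall x, H x -> H (lg_inv x))].

Definition is_normal_subgroup (G : lgroup) (H : set G) : Prop :=
  is_subgroup H /\
  forall g x, H x -> H (lg_mul (lg_mul g x) (lg_inv g)).

Definition derived_subgroup (G : lgroup) (H : set G) : set G :=
  smallest (@is_subgroup G)
    [set lg_mul (lg_mul x y) (lg_mul (lg_inv x) (lg_inv y)) | x in H & y in H].

Definition solvable_group (G : lgroup) : Prop :=
  exists k, iter k (@derived_subgroup G) setT = [set lg_one G].

(* Elements of the dual of the Lie algebra are row vectors too, with components
   relative to the dual basis. *)
Definition pairing (n : nat) (mu xi : 'rV[R]_n) : R := (mu *m xi^T) 0 0.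

Definition Ad (G : lgroup) (g : G) : 'rV[R]_(mdim G) -> 'rV[R]_(mdim G) :=
  tmap (fun h : G => lg_mul (lg_mul g h) (lg_inv g))
    (lg_chart G) (lg_chart G) (lg_one G).

(* The bracket is the derivative of [Ad] at the identity. *)
Definition bracket (G : lgroup) (xi eta : 'rV[R]_(mdim G)) : 'rV[R]_(mdim G) :=
  let c := mchart (lg_chart G) in
  'd (fun y => Ad (cinv c y) eta) (cmap c (lg_one G)) xi.

(* <coad g mu, xi> = <mu, Ad g^-1 xi> *)
Definition coad (G : lgroup) (g : G) (mu : 'rV[R]_(mdim G)) :
    'rV[R]_(mdim G) :=
  \row_k pairing mu (Ad (lg_inv g) (delta_mx 0 k)).

Definition coad_orbit (G : lgroup) (mu : 'rV[R]_(mdim G)) :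
    set 'rV[R]_(mdim G) := [set coad g mu | g in [set: G]].

(* The transpose g^* -> n^* of the tangent map at 1 of [iota : N -> G]. *)
Definition lie_restr (N G : lgroup) (iota : N -> G) (mu : 'rV[R]_(mdim G)) :
    'rV[R]_(mdim N) :=
  \row_k pairing mu
    (tmap iota (lg_chart N) (lg_chart G) (lg_one N) (delta_mx 0 k)).

Definition is_smooth_action (G : lgroup) (M : charted) (act : G -> M -> M) :
    Prop :=
  [/\ (forall x, act (lg_one G) x = x),
      (forall g h x, act (lg_mul g h) x = act g (act h x))
    & @smooth (prod_mfd G M) M (fun z => act z.1 z.2)].

(* The value at [x], in the chart [i], of the vector field by which [xi] acts:
   xi_M(x) = d/dt exp(t xi) . x at t = 0. *)
Definition fund_vec (G : lgroup) (M : charted) (act : G -> M -> M)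
    (i : mindex M) (x : M) (xi : 'rV[R]_(mdim G)) : 'rV[R]_(mdim M) :=
  tmap (fun g : G => act g x) (lg_chart G) i (lg_one G) xi.

Record ham_space (G : lgroup) := HamSpace {
  hs_mfd :> charted;
  hs_form : form2 hs_mfd;
  hs_act : G -> hs_mfd -> hs_mfd;
  hs_mom : hs_mfd -> 'rV[R]_(mdim G)
}.

(* Sign convention: i(xi_M) w = - d <Phi, xi>. *)
Definition is_moment_map (G : lgroup) (P : ham_space G) : Prop :=
  @smooth P (vec_mfd (mdim G)) (@hs_mom G P) /\
  (forall i (x : P), cdom (mchart i) x ->
   forall (xi : 'rV[R]_(mdim G)) (v : 'rV[R]_(mdim P)),
     form_eval (@hs_form G P) i x (fund_vec (@hs_act G P) i x xi) v =
     - 'd (fun y => pairing (hs_mom (cinv (mchart i) y)) xi)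
          (cmap (mchart i) x) v).

Definition is_hamiltonian (G : lgroup) (P : ham_space G) : Prop :=
  [/\ is_manifold P /\ is_symplectic (@hs_form G P),
      is_smooth_action (@hs_act G P),
      (forall g, is_pullback (@hs_act G P g) (@hs_form G P) (@hs_form G P)),
      is_moment_map P
    & (forall g (x : P), hs_mom (hs_act g x) = coad g (hs_mom x))].

Definition is_homogeneous (G : lgroup) (P : ham_space G) : Prop :=
  (exists x : P, True) /\ forall x y : P, exists g, hs_act g x = y.

Definition ham_iso (G : lgroup) (P Q : ham_space G) : Prop :=
  exists (f : P -> Q) (f' : Q -> P),
  [/\ cancel f f' /\ cancel f' f,
      smooth f /\ smooth f',
      (forall g x, f (hs_act g x) = hs_act g (f x)),
      is_pullback f (@hs_form G Q) (@hs_form G P)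
    & (forall x, hs_mom (f x) = hs_mom x)].

Definition prod_ham (G : lgroup) (P Q : ham_space G) : ham_space G :=
  @HamSpace G (prod_mfd P Q)
    (fun ij z => block_mx (hs_form ij.1 z.1) 0 0 (hs_form ij.2 z.2))
    (fun g z => (hs_act g z.1, hs_act g z.2))
    (fun z => hs_mom z.1 + hs_mom z.2).

Definition triv_ham (G : lgroup) (T : charted) (w : form2 T) : ham_space G :=
  @HamSpace G T w (fun _ t => t) (fun _ => 0).

(* [U] has the subspace topology; the sheets over the evenly covered set
   [V `&` U] are the [S k]. *)
Definition is_covering (T : topologicalType) (d : nat) (f : T -> 'rV[R]_d)
    (U : set 'rV[R]_d) : Prop :=
  [/\ continuous f,
      range f = U
    & (forall u, U u -> exists (V : set 'rV[R]_d) (K : Type) (S : K -> set T),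
       [/\ open V /\ V u,
           f @^-1` V = \bigcup_k S k,
           trivIset setT S
         & (forall k, [/\ open (S k),
              {in S k &, injective f},
              f @` S k = V `&` U
            & (forall O, open O -> O `<=` S k ->
                 exists2 W, open W & f @` O = W `&` U)])])].

Definition is_primary (G : lgroup) (P : ham_space G) (U : set 'rV[R]_(mdim G)) :
    Prop :=
  (exists mu, U = coad_orbit mu) /\ range (@hs_mom G P) = U.

Definition is_splitting (G : lgroup) (P : ham_space G)
    (U : set 'rV[R]_(mdim G)) (Ub : ham_space G) (T : charted) (w : form2 T) :
    Prop :=
  [/\ is_hamiltonian Ub /\ is_homogeneous Ub,
      is_covering (@hs_mom G Ub) U,
      is_manifold T /\ is_symplectic w
    & ham_iso P (prod_ham Ub (triv_ham G w))].

Definition splits (G : lgroup) (P : ham_space G) (U : set 'rV[R]_(mdim G)) :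
    Prop :=
  exists (Ub : ham_space G) (T : charted) (w : form2 T), is_splitting P U Ub w.

Definition splits_trivially (G : lgroup) (P : ham_space G)
    (U : set 'rV[R]_(mdim G)) : Prop :=
  exists (Ub : ham_space G) (T : charted) (w : form2 T),
    is_splitting P U Ub w /\ set_bij setT U (@hs_mom G Ub).

Definition splits_nontrivially (G : lgroup) (P : ham_space G)
    (U : set 'rV[R]_(mdim G)) : Prop :=
  exists (Ub : ham_space G) (T : charted) (w : form2 T),
    is_splitting P U Ub w /\ ~ set_bij setT U (@hs_mom G Ub).

(* The orbits considered below are embedded submanifolds of g^*, so their
   manifold structure (that of G / G_x) is the one given by [sub_mfd].
   An orbit [S] is stable under [coad], so the default [x] is never used. *)
Definition orbit_act (G : lgroup) (S : set 'rV[R]_(mdim G)) (g : G) (x : S) :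
    S := insubd x (coad g (set_val x)).

(* The Kirillov-Kostant-Souriau form: w(xi_S(x), eta_S(x)) = <x, [eta, xi]>,
   the sign being that for which S -> g^* satisfies [is_moment_map]. *)
Definition is_KKS (G : lgroup) (n : nat) (S : set 'rV[R]_(mdim G))
    (w : form2 (sub_mfd n S)) : Prop :=
  is_form2 w /\
  (forall i (x : sub_mfd n S), cdom (mchart i) x ->
   forall xi eta : 'rV[R]_(mdim G),
     form_eval w i x
       (@fund_vec G (sub_mfd n S) (@orbit_act G S) i x xi)
       (@fund_vec G (sub_mfd n S) (@orbit_act G S) i x eta)
     = pairing (set_val x) (bracket eta xi)).

(* The orbit [S] of [G], with a 2-form [w], viewed as an [N]-space by means of
   [iota : N -> G]. *)
Definition orbit_ham (N G : lgroup) (iota : N -> G) (n : nat)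
    (S : set 'rV[R]_(mdim G)) (w : form2 (sub_mfd n S)) : ham_space N :=
  @HamSpace N (sub_mfd n S) w
    (fun h x => orbit_act (iota h) x)
    (fun x => lie_restr iota (set_val x)).

End Smooth.

Section Groups.
Variable R : realType.

(* [R[i]] with the topology of its norm *)
Notation C := (R[i]%C : numFieldType).

(* e^{ja} with j = 2 pi sqrt(-1) *)
Definition expj (a : R) : R[i] :=
  (cos (2 * pi * a) +i* sin (2 * pi * a))%C.

Definition gmx (a : R) (b : R[i]) (c e f : R) : 'M[C]_5 :=
  \matrix_(k, l) nth 0 (nth [::]
    [:: [:: 1; c%:C%C; 0;      e%:C%C; f%:C%C];
        [:: 0; 1;      0;      0;      e%:C%C];
        [:: 0; 0;      expj a; 0;      b     ];
        [:: 0; 0;      0;      1;      a%:C%C];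
        [:: 0; 0;      0;      0;      1     ] ] k) l.

Definition Gset : set 'M[C]_5 :=
  [set g | exists a b c e f, g = gmx a b c e f].

Definition Nset : set 'M[C]_5 := [set g | exists a b f, g = gmx a b 0 0 f].

Lemma expjD a a' : expj (a + a') = expj a * expj a'.
Proof.
rewrite /expj mulrDr cosD sinD.
by apply/eqP; rewrite eq_complex /=; apply/andP; split; apply/eqP; ring.
Qed.

Lemma gmx_mul a b c e f a' b' c' e' f' :
  gmx a b c e f *m gmx a' b' c' e' f' =
  gmx (a + a') (b + expj a * b') (c + c') (e + e')
      (f + f' + c * e' + e * a').
Proof.
apply/matrixP => k l; rewrite !mxE !big_ord_recl big_ord0 !mxE.
case: k => [[|[|[|[|[|k]]]]] hk] //=; case: l => [[|[|[|[|[|l]]]]] hl] //=;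
  rewrite ?mul0r ?mulr0 ?mul1r ?mulr1 ?add0r ?addr0 ?expjD //;
  rewrite ?(rmorphD, rmorphM) /=; ring.
Qed.

Lemma gmx1 : gmx 0 0 0 0 0 = 1%:M.
Proof.
apply/matrixP => k l; rewrite !mxE.
by case: k => [[|[|[|[|[|k]]]]] hk] //=; case: l => [[|[|[|[|[|l]]]]] hl] //=;
  rewrite /expj mulr0 cos0 sin0.
Qed.

Lemma gmx_inv a b c e f :
  invmx (gmx a b c e f) =
  gmx (- a) (- (expj (- a) * b)) (- c) (- e) (- f + c * e + e * a).
Proof.
set g := gmx a b c e f; set h := gmx (- a) _ _ _ _.
have hg : h *m g = 1%:M.
  rewrite /h /g gmx_mul -gmx1; congr gmx; ring.
have ug : g \in unitmx by case/mulmx1_unit: hg.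
by rewrite -[h]mulmx1 -(mulmxV ug) mulmxA hg mul1mx.
Qed.

Lemma Gset_mul g h : Gset g -> Gset h -> Gset (g *m h).
Proof.
move=> [a [b [c [e [f ->]]]]] [a' [b' [c' [e' [f' ->]]]]].
by rewrite gmx_mul; do 5 eexists.
Qed.

Lemma Gset_inv g : Gset g -> Gset (invmx g).
Proof. by move=> [a [b [c [e [f ->]]]]]; rewrite gmx_inv; do 5 eexists. Qed.

Lemma Gset_one : Gset 1%:M.
Proof. by rewrite -gmx1; do 5 eexists. Qed.

Lemma Nset_mul g h : Nset g -> Nset h -> Nset (g *m h).
Proof.
move=> [a [b [f ->]]] [a' [b' [f' ->]]].
by rewrite gmx_mul !addr0; do 3 eexists.
Qed.

Lemma Nset_inv g : Nset g -> Nset (invmx g).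
Proof.
by move=> [a [b [f ->]]]; rewrite gmx_inv oppr0; do 3 eexists.
Qed.

Lemma Nset_one : Nset 1%:M.
Proof. by rewrite -gmx1; do 3 eexists. Qed.

Lemma Nset_Gset g : Nset g -> Gset g.
Proof. by move=> [a [b [f ->]]]; do 5 eexists. Qed.

Lemma Gset_gmx a b c e f : Gset (gmx a b c e f).
Proof. by do 5 eexists. Qed.

Lemma Nset_gmx a b f : Nset (gmx a b 0 0 f).
Proof. by do 3 eexists. Qed.

Definition mkG (g : 'M[C]_5) (hg : Gset g) : Gset := SigSub (mem_set hg).
Definition mkN (g : 'M[C]_5) (hg : Nset g) : Nset := SigSub (mem_set hg).

Notation o5 k := (@Ordinal 5 k isT).
Notation row_of n s := (\row_(k < n) nth 0 s k).

(* Global coordinates (a, Re b, Im b, c, e, f) on [G], and (a, Re b, Im b, f)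
   on [N]; their differentials at 1 are the bases of g and n in use. *)
Definition G_chart : chart R Gset 6 :=
  Chart setT
    (fun g : Gset => let m := set_val g in
      row_of 6 [:: complex.Re (m (o5 3) (o5 4)); complex.Re (m (o5 2) (o5 4));
                   complex.Im (m (o5 2) (o5 4)); complex.Re (m (o5 0) (o5 1));
                   complex.Re (m (o5 0) (o5 3)); complex.Re (m (o5 0) (o5 4))])
    (fun v : 'rV[R]_6 => let x k := v 0 (inord k) in
      mkG (Gset_gmx (x 0) (x 1 +i* x 2)%C (x 3) (x 4) (x 5))).

Definition N_chart : chart R Nset 4 :=
  Chart setT
    (fun g : Nset => let m := set_val g in
      row_of 4 [:: complex.Re (m (o5 3) (o5 4)); complex.Re (m (o5 2) (o5 4));
                   complex.Im (m (o5 2) (o5 4)); complex.Re (m (o5 0) (o5 4))])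
    (fun v : 'rV[R]_4 => let x k := v 0 (inord k) in
      mkN (Nset_gmx (x 0) (x 1 +i* x 2)%C (x 3))).

Definition GG : lgroup R :=
  @LGroup R (@Charted R Gset 6 unit (fun _ => G_chart))
    (mkG Gset_one)
    (fun g h => mkG (Gset_mul (set_valP g) (set_valP h)))
    (fun g => mkG (Gset_inv (set_valP g)))
    tt.

Definition NN : lgroup R :=
  @LGroup R (@Charted R Nset 4 unit (fun _ => N_chart))
    (mkN Nset_one)
    (fun g h => mkN (Nset_mul (set_valP g) (set_valP h)))
    (fun g => mkN (Nset_inv (set_valP g)))
    tt.

Definition N_incl (g : NN) : GG := mkG (Nset_Gset (set_valP (g : Nset))).

(* Components, in the basis (da, d Re b, d Im b, dc, de, df), of
   p da + Re (conj z db) - r dc - s de - t df. *)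
Definition gdual (p : R) (z : R[i]) (r s t : R) : 'rV[R]_(mdim GG) :=
  row_of 6 [:: p; complex.Re z; complex.Im z; - r; - s; - t].

Definition ndual (p : R) (z : R[i]) (t : R) : 'rV[R]_(mdim NN) :=
  row_of 4 [:: p; complex.Re z; complex.Im z; - t].

Definition orbX : set 'rV[R]_(mdim GG) := coad_orbit (gdual 0 1 0 0 1).

Definition orbU : set 'rV[R]_(mdim NN) :=
  [set ndual p (expj q) 1 | p in [set: R] & q in [set: R]].

(* [X] as a hamiltonian [N]-space, given its 2-form. *)
Definition X_ham (w : form2 (sub_mfd 4 orbX)) : ham_space NN :=
  orbit_ham N_incl w.

End Groups.

Arguments GG : clear implicits.
Arguments NN : clear implicits.
Arguments orbX : clear implicits.
Arguments orbU : clear implicits.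

(* Main.v *)
From HB Require Import structures.
Require Import Defs.
From mathcomp Require Import all_boot all_order all_algebra.
From mathcomp Require Import complex ring lra.
From mathcomp Require Import all_classical all_reals all_analysis.

(* Nothing but topology obstructs a splitting.  If f : X -> Ub * T is a
   splitting, the first component of f maps the line of all (0, 1, 0, s, 1) in X, whose
   image under the moment map is a single point of U, into one fibre of the
   covering Ub -> U; it is therefore constant on that line.  But the
   element a = 1 of N takes the point s = 0 to the point s = 1 and acts
   trivially on T, so f has the same value at both, against its injectivity.

   For the hamiltonian structure, X is described inside g^* by x^2 + y^2 = 1,
   t = 1, and any form satisfying the KKS identity is, in every chart, the
   pull-back of the ambient form dp /\ dq + dr /\ ds - dr /\ dq, with
   dq = (x dy - y dx) / 2 pi, because the fundamental vector fields span the
   tangent spaces. *)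

Set Implicit Arguments.
Unset Strict Implicit.
Unset Printing Implicit Defensive.

Import Order.TTheory GRing.Theory Num.Theory numFieldNormedType.Exports.

Local Open Scope classical_set_scope.
Local Open Scope ring_scope.

(** * Differentials and functions of class C^k *)

Section Differentials.
Variable R : realType.
Implicit Types U V W : normedModType R.

(** On the universal cover of [X], where q is a real number, s - q becomes a function, the KKS form
    reads dp /\ dq + dr /\ d(s - q), and [N] fixes both r and s - q. That cover is a product with
    the (r, s - q)-plane as second factor, and [X] is its quotient by the translation (q, s - q) ->
    (q + 1, s - q - 1): what obstructs a splitting is monodromy. A nontrivial covering [Ub] could by
    itself let a = 1 move points over a fixed point of [U]. Connectedness of the fibres of [X],
    which are (r, s)-planes, excludes this, so one argument serves both kinds of splitting.

    The length comes from the hamiltonian structure. The atlas of an embedded submanifold consists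
    of all its charts, so a 2-form has to be controlled in arbitrary unknown coordinates. Tangent
    vectors are therefore pushed into the ambient space, where tangency, action and form have
    explicit formulas, and the immersion property brings conclusions back. Closedness then rests on
    the symmetry of the second derivatives of the inclusion. *)

Lemma is_diff_near0 V W (h : V -> W) (x : V) :
  (\forall y \near x, h y = 0) -> is_diff x h 0.
Proof.
move=> h0.
have hs : h \o shift x = cst (h x) + \0 +o_ 0 id.
  apply/eqaddoP => _/posnumP[e].
  rewrite (nbhs_singleton h0).
  have : \forall y \near 0, h (y + x) = 0.
    move: h0; rewrite (near_shift 0 x) => h0; apply: filterS h0 => y /=.
    by rewrite subr0.
  apply: filterS => y /= hy.
  by rewrite !fctE /= hy /cst addr0 subr0 normr0 mulr_ge0.
have dh : 'd h x = \0 :> (V -> W) by apply: diff_unique => //; exact: cst_continuous.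
apply: DiffDef => //.
by apply/diff_locallyP; rewrite dh; split => //; exact: cst_continuous.
Qed.

(** Chart maps carry junk values off their domains, so the calculus has to depend on germs only. The
    perturbation [g - f] has zero germ at [x], hence differential 0. *)
Lemma is_diff_near V W (f g df : V -> W) (x : V) :
  (\forall y \near x, f y = g y) -> is_diff x f df -> is_diff x g df.
Proof.
move=> fg dfx.
have -> : g = f + (g - f) by rewrite addrC subrK.
have d0 : is_diff x (g - f) 0.
  apply: is_diff_near0.
  by apply: filterS fg => y /= fgy; rewrite !fctE fgy subrr.
by have := is_diffD dfx d0; rewrite addr0.
Qed.

Lemma differentiable_near V W (f g : V -> W) (x : V) :
  (\forall y \near x, f y = g y) -> differentiable f x -> differentiable g x.
Proof. by move=> fg /differentiableP /(is_diff_near fg)[]. Qed.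

Lemma diff_near V W (f g : V -> W) (x : V) :
  (\forall y \near x, f y = g y) -> differentiable f x ->
  'd g x = 'd f x :> (V -> W).
Proof. by move=> fg /differentiableP /(is_diff_near fg)[]. Qed.

Lemma diff_comp_lin U V W (L : {linear V -> W}) (f : U -> V) (x : U) :
  continuous L -> differentiable f x ->
  differentiable (L \o f) x /\ 'd (L \o f) x = L \o 'd f x :> (U -> W).
Proof.
move=> cL df; have dL := linear_differentiable (f x) cL.
split; first exact: differentiable_comp.
by rewrite diff_comp // diff_lin.
Qed.

End Differentials.

Section Ck.
Variable R : realType.
Implicit Types U V W : normedModType R.

Lemma sub_Ck_on V W k (A B : set V) (f : V -> W) :
  A `<=` B -> Ck_on k B f -> Ck_on k A f.
Proof.
move=> AB; elim: k f => [|k IH] f /=; first by move=> H x /AB; exact: H.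
by case=> H1 H2; split=> [x /AB|v]; [exact: H1|exact/IH/H2].
Qed.

(** Differentials at a point of [A] see a full neighbourhood. Openness turns agreement on [A] into
    agreement of germs, which then passes to the directional derivatives. *)
Lemma eq_Ck_on V W k (A : set V) (f g : V -> W) :
  open A -> (forall x, A x -> f x = g x) -> Ck_on k A f -> Ck_on k A g.
Proof.
move=> oA; elim: k f g => [|k IH] f g fg /=.
  move=> cf x Ax; have nA : nbhs x A by exact: open_nbhs_nbhs.
  have fgx : \forall y \near x, f y = g y by apply: filterS nA.
  have := cf _ Ax; rewrite /prop_for /continuous_at -fg //.
  apply: cvg_trans; apply: near_eq_cvg.
  by apply: filterS fgx => y /= ->.
have fgn x : A x -> \forall y \near x, f y = g y.
  by move=> Ax; have nA : nbhs x A by [exact: open_nbhs_nbhs]; apply: filterS nA.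
case=> df ddf; split=> [x Ax|v].
  exact: differentiable_near (fgn _ Ax) (df _ Ax).
apply: IH (ddf v) => x Ax.
exact: esym (congr1 (@^~ v) (diff_near (fgn _ Ax) (df _ Ax))).
Qed.

(** [Ck_on] takes differentials in the whole space and is checked point by point, so regularity can
    be collected from a different set [B] at each point. *)
Lemma local_Ck_on V W k (A : set V) (f : V -> W) :
  (forall x, A x -> exists2 B, B x & Ck_on k B f) -> Ck_on k A f.
Proof.
elim: k f => [|k IH] f H /=.
  by move=> x /H[B Bx cB]; exact: cB.
split=> [x /H[B Bx [Bd _]]|v]; first exact: Bd.
by apply: IH => x /H[B Bx [_ H2]]; exists B => //; exact: H2.
Qed.

Lemma Ck_onS V W k (A : set V) (f : V -> W) : Ck_on k.+1 A f -> Ck_on k A f.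
Proof.
elim: k f => [|k IH] f [H1 H2].
  by move=> x Ax; exact/differentiable_continuous/H1.
by split=> // v; exact/IH/H2.
Qed.

Lemma Ck_on_cst V W k (A : set V) (a : W) : Ck_on k A (cst a).
Proof.
elim: k a => [|k IH] a; first by move=> x _; exact: cst_continuous.
split=> [x _|v]; first exact: differentiable_cst.
rewrite (_ : (fun x => _) = cst 0); first exact: IH.
by apply/funext => x; rewrite diff_cst.
Qed.

Lemma Ck_on_lin V W k (A : set V) (L : {linear V -> W}) :
  continuous L -> Ck_on k A L.
Proof.
case: k => [|k] cL; first by move=> x _; exact: cL.
split=> [x _|v]; first exact: linear_differentiable.
rewrite (_ : (fun x => _) = cst (L v)); first exact: Ck_on_cst.
by apply/funext => x; rewrite diff_lin.
Qed.

Lemma Ck_on_comp_lin U V W k (A : set U) (L : {linear V -> W}) (f : U -> V) :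
  open A -> continuous L -> Ck_on k A f -> Ck_on k A (L \o f).
Proof.
move=> oA cL; elim: k f => [|k IH] f /=.
  by move=> cf x Ax; apply: continuous_comp; [exact: cf|exact: cL].
case=> df ddf; split=> [x Ax|v].
  by have [] := diff_comp_lin cL (df _ Ax).
apply: (@eq_Ck_on _ _ _ _ (L \o (fun x => 'd f x v))) => //; last exact/IH/ddf.
by move=> x Ax /=; exact: esym (congr1 (@^~ v) (diff_comp_lin cL (df _ Ax)).2).
Qed.

Lemma Ck_onD V W k (A : set V) (f g : V -> W) : open A ->
  Ck_on k A f -> Ck_on k A g -> Ck_on k A (fun x => f x + g x).
Proof.
move=> oA; elim: k f g => [|k IH] f g.
  by move=> cf cg x Ax; apply: continuousD; [exact: cf|exact: cg].
case=> df ddf [dg ddg]; split=> [x Ax|v].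
  by apply: differentiableD; [exact: df|exact: dg].
apply: (@eq_Ck_on _ _ _ _ (fun x => 'd f x v + 'd g x v)) => //; last exact: IH (ddf v) (ddg v).
by move=> x Ax; exact: esym (congr1 (@^~ v) (diffD (df _ Ax) (dg _ Ax))).
Qed.

Lemma Ck_on_sum V W k (A : set V) (I : Type) (r : seq I) (f : I -> V -> W) :
  open A -> (forall i, Ck_on k A (f i)) ->
  Ck_on k A (fun x => \sum_(i <- r) f i x).
Proof.
move=> oA fA; elim: r => [|i r IH].
  by apply: (eq_Ck_on oA _ (Ck_on_cst _ _ 0)) => x _; rewrite big_nil.
apply: (eq_Ck_on oA _ (Ck_onD oA (fA i) IH)) => x _ /=.
by rewrite big_cons.
Qed.


(** The Leibniz rule pairs each function with the derivative of the other, so the induction also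
    calls for the functions themselves, lowered by one order with [Ck_onS]. *)
Lemma Ck_onM V k (A : set V) (f g : V -> R) : open A ->
  Ck_on k A f -> Ck_on k A g -> Ck_on k A (fun x => f x * g x).
Proof.
move=> oA; elim: k f g => [|k IH] f g.
  by move=> cf cg x Ax; apply: continuousM; [exact: cf|exact: cg].
move=> Cf Cg; have [df ddf] := Cf; have [dg ddg] := Cg.
split=> [x Ax|v]; first by apply: differentiableM; [exact: df|exact: dg].
apply: (@eq_Ck_on _ _ _ _ (fun x => f x * 'd g x v + g x * 'd f x v)) => //.
  by move=> x Ax; exact: esym (congr1 (@^~ v) (diffM (df _ Ax) (dg _ Ax))).
apply: Ck_onD => //; first by apply: IH; [exact: Ck_onS|exact: ddg].
by apply: IH; [exact: Ck_onS|exact: ddf].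
Qed.

Lemma Ck_onN V W k (A : set V) (f : V -> W) : open A ->
  Ck_on k A f -> Ck_on k A (fun x => - f x).
Proof.
move=> oA; elim: k f => [|k IH] f.
  by move=> cf x Ax; apply: continuousN; exact: cf.
case=> df ddf; split=> [x Ax|v]; first by apply: differentiableN; exact: df.
apply: (@eq_Ck_on _ _ _ _ (fun x => - 'd f x v)) => //; last exact/IH/ddf.
by move=> x Ax; exact: esym (congr1 (@^~ v) (diffN (df _ Ax))).
Qed.

Lemma scalel_lin_continuous W (w : W) :
  exists2 L : {linear R -> W}, L =1 *:%R^~ w & continuous L.
Proof.
have Llin : linear ( *:%R^~ w : R -> W) by move=> u y z; rewrite scalerDl scalerA.
pose Lm := GRing.isLinear.Build _ _ _ _ _ Llin.
pose L : {linear R -> W} := HB.pack (fun k : R => k *: w) Lm.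
by exists L => //; exact: scalel_continuous.
Qed.

Lemma coord_lin_continuous m n (i : 'I_m) (j : 'I_n) :
  exists2 L : {linear 'M[R]_(m, n) -> R},
    L =1 (fun N : 'M[R]_(m, n) => N i j) & continuous L.
Proof.
have Llin : linear (fun N : 'M[R]_(m, n) => N i j) by move=> u y z; rewrite !mxE.
pose Lm := GRing.isLinear.Build _ _ _ _ _ Llin.
pose L : {linear 'M[R]_(m, n) -> R} := HB.pack (fun N : 'M[R]_(m, n) => N i j) Lm.
by exists L => // x; exact: coord_continuous.
Qed.

Lemma Ck_on_coord V m n k (A : set V) (f : V -> 'M[R]_(m, n)) i j :
  open A -> Ck_on k A f -> Ck_on k A (fun x => f x i j).
Proof.
move=> oA Cf; have [L LE cL] := coord_lin_continuous i j.
apply: (eq_Ck_on oA _ (Ck_on_comp_lin oA cL Cf)) => x _ /=.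
by rewrite LE.
Qed.

Lemma Ck_on_mx V m n k (A : set V) (f : V -> 'M[R]_(m, n)) :
  open A -> (forall i j, Ck_on k A (fun x => f x i j)) -> Ck_on k A f.
Proof.
move=> oA Cf.
apply: (@eq_Ck_on _ _ _ _
  (fun x => \sum_i \sum_j (f x i j *: delta_mx i j : 'M[R]_(m, n)))) => //.
  by move=> x _; rewrite -matrix_sum_delta.
apply: Ck_on_sum => // i; apply: Ck_on_sum => // j.
have [L LE cL] := scalel_lin_continuous (delta_mx i j : 'M[R]_(m, n)).
apply: (eq_Ck_on oA _ (Ck_on_comp_lin oA cL (Cf i j))) => x _ /=.
by rewrite LE.
Qed.

(* The basis [e] with coordinates [c] lets the chain rule be written with
   products of scalar functions. *)
Lemma Ck_on_comp_basis U V n (e : 'I_n -> V) (c : 'I_n -> {linear V -> R})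
    k (A : set U) (B : set V) (f : U -> V) (g : V -> R) :
  (forall i, continuous (c i)) -> (forall v, v = \sum_i c i v *: e i) ->
  open A -> (forall x, A x -> B (f x)) ->
  Ck_on k A f -> Ck_on k B g -> Ck_on k A (g \o f).
Proof.
move=> cc ce oA AB; elim: k f AB g => [|k IH] f AB g.
  by move=> cf cg x Ax; apply: continuous_comp; [exact: cf|exact/cg/AB].
move=> Cf Cg; have [df ddf] := Cf; have [dg ddg] := Cg.
split=> [x Ax|v].
  by apply: differentiable_comp; [exact: df|exact/dg/AB].
apply: (@eq_Ck_on _ _ _ _
  (fun x => \sum_i c i ('d f x v) * 'd g (f x) (e i))) => //.
  move=> x Ax; rewrite (diff_comp (df _ Ax) (dg _ (AB _ Ax))) /=.
  rewrite [in RHS](ce ('d f x v)) linear_sum /=.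
  by apply: eq_bigr => i _; rewrite linearZ.
apply: Ck_on_sum => // i; apply: Ck_onM => //.
  exact: (@Ck_on_comp_lin _ _ _ _ _ (c i) (fun x => 'd f x v) oA (cc i) (ddf v)).
by apply: (IH f AB (fun y => 'd g y (e i))); [exact: Ck_onS|exact: ddg].
Qed.

Lemma Ck_on_compR U k (A : set U) (B : set R) (f : U -> R) (g : R -> R) :
  open A -> (forall x, A x -> B (f x)) ->
  Ck_on k A f -> Ck_on k B g -> Ck_on k A (fun x => g (f x)).
Proof.
move=> oA AB Cf Cg.
have H := @Ck_on_comp_basis U R 1 (fun _ => 1) (fun _ => idfun) k A B f g.
apply: H => //; first by move=> _ x; exact: cvg_id.
by move=> v; rewrite big_ord1 /= [RHS]mulr1.
Qed.

Lemma Ck_on_comp_rV U n k (A : set U) (B : set 'rV[R]_n) (f : U -> 'rV[R]_n)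
    (g : 'rV[R]_n -> R) :
  open A -> (forall x, A x -> B (f x)) ->
  Ck_on k A f -> Ck_on k B g -> Ck_on k A (g \o f).
Proof.
have /choice[c Hc] : forall i : 'I_n, exists c : {linear 'rV[R]_n -> R},
    c =1 (fun N : 'rV[R]_n => N 0 i) /\ continuous c.
  by move=> i; have [L LE cL] := coord_lin_continuous (0 : 'I_1) i; exists L.
apply: (@Ck_on_comp_basis _ _ n (fun i => delta_mx 0 i) c).
  by move=> i; have [] := Hc i.
move=> v; rewrite {1}[v]row_sum_delta; apply: eq_bigr => i _.
by rewrite (Hc i).1.
Qed.

Lemma Ck_on_inv k : Ck_on k [set x : R | x != 0] (fun x => x^-1).
Proof.
have oA : open [set x : R | x != 0].
  rewrite (_ : [set x | _] = ~` [set 0]); last by apply/seteqP; split => x /= /eqP.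
  exact/closed_openC/closed_eq.
elim: k => [|k IH]; first by move=> x /= x0; exact: inv_continuous.
split=> [x /= x0|v]; first exact: differentiable_Rinv.
apply: (@eq_Ck_on _ _ _ _ (fun x : R => - v * (x^-1 * x^-1))) => //.
  move=> x /= x0; rewrite diff_Rinv //= -exprVn expr2 scaleNr.
  by rewrite /GRing.scale /= mulNr mulrC.
by apply: Ck_onM => //; [exact: Ck_on_cst|exact: Ck_onM].
Qed.

Lemma diff_1 (f : R -> R) (x d v : R) : is_derive x 1 f d ->
  differentiable f x /\ 'd f x v = v * d.
Proof.
move=> [] /[dup] /derivable1_diffP df dd fd; split => //.
by rewrite (diff1E df) derive1E fd.
Qed.

Lemma Ck_on_sincos k (A : set R) : Ck_on k A (@sin R) /\ Ck_on k A (@cos R).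
Proof.
(* The derivatives are compared through [eq_Ck_on], which asks for an open set. *)
wlog -> : A / A = setT.
  by move=> /(_ setT erefl)[H1 H2]; split; apply: sub_Ck_on (@subsetT _ A) _.
elim: k => [|k [IHs IHc]].
  by split=> x _; [exact: continuous_sin|exact: continuous_cos].
split; split=> [x _|v].
- by case: (diff_1 0 (is_derive_sin x)).
- apply: (@eq_Ck_on _ _ _ _ (fun x => v * cos x)); first exact: openT.
    by move=> x _; rewrite (diff_1 v (is_derive_sin x)).2.
  by apply: Ck_onM => //; [exact: openT|exact: Ck_on_cst].
- by case: (diff_1 0 (is_derive_cos x)).
- apply: (@eq_Ck_on _ _ _ _ (fun x => v * - sin x)); first exact: openT.
    by move=> x _; rewrite (diff_1 v (is_derive_cos x)).2.
  apply: Ck_onM => //; [exact: openT|exact: Ck_on_cst|].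
  by apply: Ck_onN => //; exact: openT.
Qed.

End Ck.

(** * Topology of matrices and subspaces *)

Section Topology.

Lemma continuous_mx (T K : topologicalType) m n (f : T -> 'M[K]_(m, n)) (x : T) :
  (forall i j, {for x, continuous (fun y => f y i j)}) -> {for x, continuous f}.
Proof.
move=> cf A [P fP PA]; rewrite nbhs_filterE.
have H : \forall y \near x, forall ij : 'I_m * 'I_n, P ij.1 ij.2 (f y ij.1 ij.2).
  by apply: filter_forall => -[i j] /=; apply: cf; exact: fP.
by apply: filterS H => y Hy; apply: PA => i j; exact: (Hy (i, j)).
Qed.

Lemma inj_hausdorff (S T : topologicalType) (f : S -> T) :
  continuous f -> injective f -> hausdorff_space T -> hausdorff_space S.
Proof.
move=> cf fI hT p q pq; apply: fI; apply: hT => A B Ap Bq.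
have [x [Ax Bx]] := pq _ _ (cf _ _ Ap) (cf _ _ Bq).
by exists (f x).
Qed.

Lemma embedded_second_countable (S T : topologicalType) (f : S -> T) :
  continuous f ->
  (forall x A, nbhs x A -> exists2 B, nbhs (f x) B & f @^-1` B `<=` A) ->
  @second_countable T -> @second_countable S.
Proof.
move=> cf fop [B cB [Bo Bb]]; exists [set f @^-1` A | A in B].
  exact: sub_countable (card_image_le _ _) cB.
split; first by move=> _ [A BA <-]; move/continuousP: cf; apply; exact: Bo.
move=> x A /fop [C /Bb[D [BD Dx] DC] CA].
exists (f @^-1` D); first by split => //; exists D.
by move=> y /= /DC; exact: CA.
Qed.

Lemma set_val_nbhs (T : topologicalType) (A : set T) (x : A) (B : set A) :
  nbhs x B -> exists2 C, nbhs (set_val x) C & set_val @^-1` C `<=` B.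
Proof.
by move=> [_ [[C oC <-] Cx CB]]; exists C => //; apply: open_nbhs_nbhs; split.
Qed.

Lemma continuous_set_val (S T : topologicalType) (A : set T) (f : S -> A) (x : S) :
  {for x, continuous (fun y => set_val (f y) : T)} -> {for x, continuous f}.
Proof.
move=> cf B /set_val_nbhs [C /cf nC CB].
have nC' : nbhs x (fun y => C (set_val (f y))) by exact: nC.
suff : nbhs x (f @^-1` B) by [].
exact: (filterS (fun y => @CB (f y)) nC').
Qed.

Lemma set_val_continuous (T : topologicalType) (A : set T) :
  continuous (set_val : A -> T).
Proof. exact: initial_continuous. Qed.

Lemma continuous_cancel_nbhs (S T : topologicalType) (f : S -> T) (g : T -> S) :
  continuous g -> cancel f g ->
  forall x A, nbhs x A -> exists2 B, nbhs (f x) B & f @^-1` B `<=` A.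
Proof.
move=> cg fK x A Ax; exists (g @^-1` A); first by apply: cg; rewrite fK.
by move=> y /=; rewrite fK.
Qed.

Lemma rV_second_countable (R : realType) n : @second_countable 'rV[R]_n.
Proof.
pose b (q : 'rV[rat]_n * nat) : set 'rV[R]_n :=
  ball (map_mx (@ratr R) q.1) (q.2.+1%:R^-1).
exists (range b).
  by apply: sub_countable (card_image_le _ _) _; exact: countableP.
split; first by move=> _ [q _ <-]; exact: ball_open.
move=> x A /nbhs_ballP[e /= e0 eA].
(* Two points of a ball of radius below [e / 2] are within [e] of each other, so a small ball with
   rational centre near [x] stays in [A]. *)
have e20 : 0 < e / 2 by rewrite divr_gt0.
have [k ke] : exists k, k.+1%:R^-1 < e / 2.
  exists (Num.bound (e / 2)^-1).
  rewrite invf_plt ?posrE //.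
  apply: lt_le_trans (archi_boundP _) _; first by rewrite invr_ge0 ltW.
  by rewrite ler_nat.
have k0 : 0 < k.+1%:R^-1 :> R by rewrite invr_gt0.
have /choice[q Hq] : forall i : 'I_n, exists q : rat,
    `|ratr q - x 0 i| < k.+1%:R^-1.
  move=> i; have [|q] := @rat_in_itvoo R (x 0 i) (x 0 i + k.+1%:R^-1).
    by rewrite ltrDl.
  rewrite inE /= => /andP[/= q1 q2]; exists q.
  by rewrite ger0_norm ?subr_ge0 ?ltW // ltrBlDl.
pose Q := \row_i q i.
exists (b (Q, k)).
  split; first by exists (Q, k).
  split => // i j; rewrite !mxE /= -ball_normE /= !ord1; exact: Hq.
move=> y [_ /= yb]; apply: eA; split => // i j.
have := yb i j; rewrite !mxE /= -ball_normE /= !ord1 => yb1.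
have xb := Hq j.
rewrite (_ : x 0 j - y 0 j = - (ratr (q j) - x 0 j) + (ratr (q j) - y 0 j)); last by ring.
apply: le_lt_trans (ler_normD _ _) _; rewrite normrN [e]splitr.
by apply: ltrD; [exact: lt_trans xb _|exact: lt_trans yb1 _].
Qed.

End Topology.

(** * Directional differentials and the symmetry of second derivatives *)

Section DirectionalDifferential.
Variable R : realType.
Implicit Types U V W : normedModType R.

(** Differentiability travels with the value in one direction, so that each rule of calculus is a
    single implication and a derivative can be synthesised by proof search. *)
Definition has_diff V W (f : V -> W) (x v : V) (d : W) : Prop :=
  differentiable f x /\ 'd f x v = d.

Lemma has_diffP V W (f : V -> W) (x v : V) :
  differentiable f x -> has_diff f x v ('d f x v).
Proof. by []. Qed.

Lemma has_diff_cst V W (a : W) (x v : V) : has_diff (fun _ => a) x v 0.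
Proof.
split; first exact: differentiable_cst.
exact: (congr1 (@^~ v) (diff_cst a x)).
Qed.

Lemma has_diffD V W (f g : V -> W) (x v : V) (a b : W) :
  has_diff f x v a -> has_diff g x v b ->
  has_diff (fun y => f y + g y) x v (a + b).
Proof.
move=> [df <-] [dg <-]; split; first exact: differentiableD.
exact: (congr1 (@^~ v) (diffD df dg)).
Qed.

Lemma has_diffN V W (f : V -> W) (x v : V) (a : W) :
  has_diff f x v a -> has_diff (fun y => - f y) x v (- a).
Proof.
move=> [df <-]; split; first exact: differentiableN.
exact: (congr1 (@^~ v) (diffN df)).
Qed.

Lemma has_diffM V (f g : V -> R) (x v : V) (a b : R) :
  has_diff f x v a -> has_diff g x v b ->
  has_diff (fun y => f y * g y) x v (f x * b + g x * a).
Proof.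
move=> [df <-] [dg <-]; split; first exact: differentiableM.
exact: (congr1 (@^~ v) (diffM df dg)).
Qed.

Lemma has_diff_comp1 V (f : V -> R) (g : R -> R) (x v : V) (a d : R) :
  is_derive (f x) 1 g d -> has_diff f x v a ->
  has_diff (fun y => g (f y)) x v (a * d).
Proof.
move=> gd [df <-]; have [dg dgE] := diff_1 ('d f x v) gd.
split; first exact: (@differentiable_comp _ _ _ _ f g).
by rewrite -dgE; exact: (congr1 (@^~ v) (diff_comp df dg)).
Qed.

Lemma has_diff_sin V (f : V -> R) (x v : V) (a : R) :
  has_diff f x v a -> has_diff (fun y => sin (f y)) x v (a * cos (f x)).
Proof. exact: has_diff_comp1 (is_derive_sin _). Qed.

Lemma has_diff_cos V (f : V -> R) (x v : V) (a : R) :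
  has_diff f x v a -> has_diff (fun y => cos (f y)) x v (a * - sin (f x)).
Proof. exact: has_diff_comp1 (is_derive_cos _). Qed.

Lemma has_diff_coord m n (x v : 'M[R]_(m, n)) i j :
  has_diff (fun y : 'M[R]_(m, n) => y i j) x v (v i j).
Proof.
have [L LE cL] := @coord_lin_continuous R m n i j.
rewrite /has_diff -(funext LE); split; first exact: linear_differentiable.
by rewrite diff_lin // LE.
Qed.

Lemma has_diff_id V (x v : V) : has_diff (fun y => y) x v v.
Proof.
have H := @is_diff_id R V x; split; first exact: ex_diff.
exact: (congr1 (@^~ v) (diff_val (is_diff_def := H))).
Qed.

Lemma differentiable_coords V m n (f : V -> 'M[R]_(m, n)) (x : V) :
  (forall i j, differentiable (fun y => f y i j) x) -> differentiable f x.
Proof.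
move=> df.
have -> : f = \sum_i \sum_j (fun y => f y i j *: delta_mx i j : 'M[R]_(m, n)).
  apply/funext => y; rewrite fct_sumE {1}(matrix_sum_delta (f y)).
  by apply: eq_bigr => i _; rewrite fct_sumE.
apply: differentiable_sum => i; apply: differentiable_sum => j.
exact: differentiableZl.
Qed.

Lemma has_diff_entry V m n (f : V -> 'M[R]_(m, n)) (x v : V)
    (d : 'M[R]_(m, n)) i j :
  has_diff f x v d -> has_diff (fun y => f y i j) x v (d i j).
Proof.
move=> [df <-]; have [L LE cL] := @coord_lin_continuous R m n i j.
have [dLf dLfE] := diff_comp_lin cL df.
have E : L \o f = (fun y => f y i j) by apply/funext => y /=; rewrite LE.
by rewrite /has_diff -E; split => //; rewrite dLfE /= LE.
Qed.

Lemma has_diff_mx V m n (f : V -> 'M[R]_(m, n)) (x v : V) (d : 'M[R]_(m, n)) :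
  (forall i j, has_diff (fun y => f y i j) x v (d i j)) -> has_diff f x v d.
Proof.
move=> H.
have df : differentiable f x.
  by apply: differentiable_coords => i j; have [] := H i j.
split => //; apply/matrixP => i j.
have [_ <-] := H i j.
by have [_ ->] := has_diff_entry i j (has_diffP v df).
Qed.

Lemma has_diff_comp U V W (f : U -> V) (g : V -> W) (x v : U) (a : V) (b : W) :
  has_diff f x v a -> has_diff g (f x) a b -> has_diff (g \o f) x v b.
Proof.
move=> [df <-] [dg <-]; split; first exact: differentiable_comp.
exact: (congr1 (@^~ v) (diff_comp df dg)).
Qed.

Lemma has_diff_near V W (f g : V -> W) (x v : V) (d : W) :
  (\forall y \near x, f y = g y) -> has_diff f x v d -> has_diff g x v d.
Proof.
move=> fg [df <-]; split; first exact: differentiable_near fg df.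
exact: (congr1 (@^~ v) (diff_near fg df)).
Qed.

Lemma has_diff_eq V W (f : V -> W) (x v : V) (d d' : W) :
  has_diff f x v d -> d = d' -> has_diff f x v d'.
Proof. by move=> H <-. Qed.

Lemma has_diff_uniq V W (f : V -> W) (x v : V) (d d' : W) :
  has_diff f x v d -> has_diff f x v d' -> d = d'.
Proof. by move=> [_ <-] [_ <-]. Qed.

Lemma has_diff_line V W (f : V -> W) (x v : V) (t : R) :
  differentiable f (x + t *: v) ->
  has_diff (fun s : R => f (x + s *: v)) t 1 ('d f (x + t *: v) v).
Proof.
move=> df; apply: (@has_diff_comp _ _ _ (fun s : R => x + s *: v) f) (has_diffP _ df).
apply: has_diff_eq; first apply: has_diffD; first exact: has_diff_cst.
  split; last by apply: (congr1 (@^~ 1)); exact: (@diffZl _ _ _ id v t).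
  exact: (@differentiableZl _ _ _ id v t).
by rewrite add0r (has_diff_id t 1).2 scale1r.
Qed.

End DirectionalDifferential.

Section Schwarz.
Variables (R : realType) (V : normedModType R).

Lemma has_diff_is_derive (f : R -> R) (t d : R) :
  has_diff f t 1 d -> is_derive t 1 f d.
Proof.
move=> [df <-]; apply: DeriveDef; first exact/derivable1_diffP.
by rewrite deriveE.
Qed.

Lemma MVT0 (f df : R -> R) (h : R) : 0 < h ->
  (forall t, 0 <= t <= h -> has_diff f t 1 (df t)) ->
  exists2 c, 0 < c < h & f h - f 0 = df c * h.
Proof.
move=> h0 Hf.
have [||c] := @MVT R f df 0 h h0.
- move=> t; rewrite in_itv /= => /andP[t0 th].
  by apply/has_diff_is_derive/Hf; rewrite !ltW.
- apply: derivable_within_continuous => t; rewrite in_itv /= => th.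
  by apply/derivable1_diffP; have [] := Hf t th.
- by rewrite in_itv /= subr0 => ch E; exists c.
Qed.

(** Two applications of the mean value theorem, first along [u] and then along [v], make the
    quotient equal to a mixed second derivative at some point of the parallelogram spanned by
    [h *: u] and [h *: v]. Continuity of that derivative at [y] does the rest. *)
Lemma second_difference (f : V -> R) (A : set V) (u v y : V) (e : R) :
  open A -> A y -> Ck_on 2 A f -> 0 < e ->
  \forall h \near (0 : R)^'+,
    `|(f (y + h *: u + h *: v) - f (y + h *: u) - f (y + h *: v) + f y)
      / (h * h) - 'd (fun z => 'd f z u) y v| < e.
Proof.
move=> oA Ay [df ddf] e0.
have [d2f d3f] := ddf u.
have ctn := d3f v y Ay.
have nA : nbhs y A by exact: open_nbhs_nbhs.
have /nbhs_ballP[r /= r0 rb] : nbhs y (A `&` [set z |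
    `|'d (fun z => 'd f z u) y v - 'd (fun z => 'd f z u) z v| < e]).
  apply: filterI => //.
  by have /cvgrPdist_lt/(_ _ e0) := ctn.
have cv : (fun h : R => h * (`|u| + `|v|)) @ (0 : R)^'+ --> (0 : R).
  have : (fun h : R => h * (`|u| + `|v|)) @ (0 : R) --> (0 * (`|u| + `|v|) : R).
    by apply: cvgMl; exact: cvg_id.
  by rewrite mul0r; exact: cvg_at_right_filter.
near=> h.
have h0 : 0 < h by near: h; exact: nbhs_right_gt.
have hr : h * (`|u| + `|v|) < r.
  near: h; have /cvgrPdist_lt/(_ _ r0) := cv.
  apply: filterS => h /=; rewrite sub0r normrN => /ltr_normlP[]; lra.
(* The whole parallelogram lies in the ball where [f] is C^2 and its mixed derivative is within [e]
   of the value at [y]. *)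
have inA s t : 0 <= s <= h -> 0 <= t <= h ->
    ball y r (y + s *: u + t *: v).
  move=> /andP[s0 sh] /andP[t0 th].
  rewrite -ball_normE /= -addrA opprD addNKr normrN.
  apply: le_lt_trans hr; apply: le_trans (ler_normD _ _) _.
  rewrite !normrZ !ger0_norm // mulrDr.
  by apply: lerD; apply: ler_wpM2r.
pose F (s : R) := f (y + s *: u + h *: v) - f (y + s *: u).
have hh : 0 <= h <= h by rewrite lexx ltW.
have oo : 0 <= (0 : R) <= h by rewrite lexx ltW.
have [|c ch Fc] := @MVT0 F (fun s => 'd f (y + s *: u + h *: v) u - 'd f (y + s *: u) u) h h0.
  move=> s sh; apply: has_diffD.
    have := @has_diff_line R V _ f (y + h *: v) u s; rewrite addrAC.
    have -> : (fun s0 : R => f (y + h *: v + s0 *: u)) = (fun s0 => f (y + s0 *: u + h *: v)).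
      by apply/funext => z; rewrite addrAC.
    by apply; apply: df; have [] := rb _ (inA _ _ sh hh).
  apply: has_diffN; apply: has_diff_line; apply: df.
  by have := inA _ _ sh oo; rewrite scale0r addr0 => /rb[].
have {}ch : 0 <= c <= h by case/andP: ch => c0 c1; rewrite !ltW.
have [|d dh Gd] := @MVT0 (fun t => 'd f (y + c *: u + t *: v) u)
    (fun t => 'd (fun z => 'd f z u) (y + c *: u + t *: v) v) h h0.
  move=> t th; apply: (@has_diff_line R V _ (fun z => 'd f z u)); apply: d2f.
  by have [] := rb _ (inA _ _ ch th).
have {}dh : 0 <= d <= h by case/andP: dh => c0 c1; rewrite !ltW.
move: Gd; rewrite scale0r addr0 => Gd; move: Fc; rewrite Gd /F !scale0r !addr0 => Fc.
have -> : f (y + h *: u + h *: v) - f (y + h *: u) - f (y + h *: v) + f y =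
  'd (fun z => 'd f z u) (y + c *: u + d *: v) v * h * h by rewrite -Fc; ring.
have hn0 : h != 0 by rewrite gt_eqF.
rewrite -(mulrA _ h h) mulfK ?mulf_neq0 // distrC.
by have [] := rb _ (inA _ _ ch dh).
Unshelve. all: by end_near. Qed.

(** The second difference is symmetric in [u] and [v], so one and the same quotient approximates
    both mixed derivatives. *)
Lemma diff_diffC (f : V -> R) (A : set V) (u v y : V) :
  open A -> A y -> Ck_on 2 A f ->
  'd (fun z => 'd f z u) y v = 'd (fun z => 'd f z v) y u.
Proof.
move=> oA Ay Cf; apply/eqP; rewrite -subr_eq0 -normr_le0; apply/ler_addgt0Pr => e e0.
have e20 : 0 < e / 2 by rewrite divr_gt0.
near (0 : R)^'+ => h.
have H1 : `|(f (y + h *: u + h *: v) - f (y + h *: u) - f (y + h *: v) + f y)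
      / (h * h) - 'd (fun z => 'd f z u) y v| < e / 2.
  by near: h; exact: second_difference oA Ay Cf e20.
have H2 : `|(f (y + h *: v + h *: u) - f (y + h *: v) - f (y + h *: u) + f y)
      / (h * h) - 'd (fun z => 'd f z v) y u| < e / 2.
  by near: h; exact: second_difference oA Ay Cf e20.
rewrite add0r; set a := 'd _ y v in H1 *; set b := 'd _ y u in H2 *.
move: H1 H2; rewrite [y + h *: v + h *: u]addrAC.
set p := f _; set q := f _; set r := f _.
have -> : p - r - q + f y = p - q - r + f y by ring.
set X := _ / _ => H1 H2.
have -> : a - b = (X - b) - (X - a) by ring.
apply: ltW; apply: le_lt_trans (ler_normB _ _) _; rewrite [e]splitr.
exact: ltrD.
Unshelve. all: by end_near. Qed.

End Schwarz.

(** * Submanifold charts *)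

Section Charts.
Variable R : realType.

Lemma open_nearP (T : topologicalType) (A : set T) :
  (forall x, A x -> nbhs x A) -> open A.
Proof. by rewrite openE. Qed.

Lemma near_continuous (S T : topologicalType) (f : S -> T) (x : S) (A : set T) :
  {for x, continuous f} -> open A -> A (f x) -> \forall y \near x, A (f y).
Proof. by move=> cf oA Ax; apply: cf; exact: open_nbhs_nbhs. Qed.

Lemma near_set_val (S : topologicalType) (T : topologicalType) (B : set T)
    (f : S -> B) (x : S) (A : set T) :
  {for x, continuous f} -> open A -> A (set_val (f x)) ->
  \forall y \near x, A (set_val (f y)).
Proof.
move=> cf oA Ax.
apply: (@near_continuous _ _ (fun y => set_val (f y) : T)) => //.
by apply: continuous_comp; [exact: cf|exact: set_val_continuous].
Qed.

Lemma chart_cinv (T : topologicalType) n (c : chart R T n) y :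
  is_chart c -> cimg c y -> cdom c (cinv c y) /\ cmap c (cinv c y) = y.
Proof. by move=> [_ _ cK _ _] [x cx <-]; rewrite cK. Qed.

Lemma chart_img_open (T : topologicalType) n (c : chart R T n) (D : set T) :
  is_chart c -> open D -> open (cmap c @` (cdom c `&` D)).
Proof.
move=> hc oD; have [oc oi cK _ ci] := hc; apply: open_nearP => y Dy.
have [x [cx Dx] xy] := Dy.
have iy : cimg c y by exists x.
have nD : nbhs y (cinv c @^-1` (cdom c `&` D)).
  apply: (ci _ iy); apply: open_nbhs_nbhs; split; first exact: openI.
  by rewrite -xy cK.
have ni : nbhs y (cimg c) by exact: open_nbhs_nbhs.
apply: filterS (filterI nD ni) => z [Dz iz].
by exists (cinv c z) => //; have [] := chart_cinv hc iz.
Qed.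

Lemma Ck_on_comp (U : normedModType R) n m p k (A : set U) (B : set 'rV[R]_n)
    (f : U -> 'rV[R]_n) (g : 'rV[R]_n -> 'M[R]_(m, p)) :
  open A -> open B -> (forall x, A x -> B (f x)) ->
  Ck_on k A f -> Ck_on k B g -> Ck_on k A (g \o f).
Proof.
move=> oA oB AB Cf Cg; apply: Ck_on_mx => // i j.
exact: (Ck_on_comp_rV oA AB Cf (Ck_on_coord i j oB Cg)).
Qed.

Lemma smooth_on_differentiable (V W : normedModType R) (A : set V) (f : V -> W) x :
  smooth_on A f -> A x -> differentiable f x.
Proof. by move=> /(_ 1)[H _] /H. Qed.

(** * Charts of an embedded submanifold *)

Section Subchart.
Variables (d n : nat) (S : set 'rV[R]_d) (c : chart R S n).
Hypothesis hc : is_subchart c.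

Let chartc : is_chart c. Proof. by have [] := hc. Qed.

Lemma incl_smooth : smooth_on (cimg c) (fun y => set_val (cinv c y) : 'rV[R]_d).
Proof. by have [] := hc. Qed.

Lemma incl_differentiable x : cdom c x ->
  differentiable (fun y => set_val (cinv c y) : 'rV[R]_d) (cmap c x).
Proof. by move=> cx; apply: smooth_on_differentiable incl_smooth _; exists x. Qed.

(** Around each point the chart map is the restriction of a smooth ambient map [F], so locally
    [cmap c \o phi] is [F] applied to the ambient expression of [phi]. *)
Lemma subchart_comp_smooth (V : normedModType R) (A : set V) (phi : V -> S) :
  open A -> (forall x, A x -> {for x, continuous phi}) ->
  (forall x, A x -> cdom c (phi x)) ->
  smooth_on A (fun x => set_val (phi x) : 'rV[R]_d) ->
  smooth_on A (cmap c \o phi).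
Proof.
move=> oA cphi dphi sphi k; apply: local_Ck_on => x Ax.
have [_ _ /(_ _ (dphi _ Ax)) [Q [F [oO Ox sF FE]]]] := hc.
pose B := A `&` [set z | Q (set_val (phi z))].
have oB : open B.
  apply: open_nearP => z [Az Oz].
  have nA : nbhs z A by exact: open_nbhs_nbhs.
  have nO : nbhs z (fun y => Q (set_val (phi y))).
    by apply: near_set_val => //; exact: cphi.
  exact: (filterI nA nO).
exists B => //.
apply: (@eq_Ck_on _ _ _ _ _ (F \o (fun x => set_val (phi x) : 'rV[R]_d))) => //.
  by move=> z [Az Oz] /=; rewrite FE //; exact: dphi.
apply: (Ck_on_comp oB oO _ _ (sF k)); first by move=> z [].
by apply: sub_Ck_on (sphi k) => z [].
Qed.

(** This transfers a velocity [w] computed in the ambient space to an unknown chart: its components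
    are [u = 'd F w], for the local ambient extension [F] of the chart map. The inclusion sends [u]
    back to [w] because near [x] it recomposes the chart expression into [phi], and differentials
    are unique. *)
Lemma subchart_tangent (V : normedModType R) (phi : V -> S) (x v : V)
    (w : 'rV[R]_d) :
  {for x, continuous phi} -> cdom c (phi x) ->
  has_diff (fun z => set_val (phi z) : 'rV[R]_d) x v w ->
  exists2 u, has_diff (cmap c \o phi) x v u &
    has_diff (fun y => set_val (cinv c y) : 'rV[R]_d) (cmap c (phi x)) u w.
Proof.
move=> cphi dphi Hphi.
have [oc _ cK _ _] := chartc.
have [_ _ /(_ _ dphi) [Q [F [oO Ox sF FE]]]] := hc.
have n1 : \forall z \near x, cdom c (phi z).
  exact: near_continuous.
have n2 : \forall z \near x, Q (set_val (phi z)).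
  exact: near_set_val.
have dF := smooth_on_differentiable sF Ox.
exists ('d F (set_val (phi x) : 'rV[R]_d) w).
  apply: has_diff_near (has_diff_comp Hphi (has_diffP w dF)).
  by apply: filterS (filterI n1 n2) => z [z1 z2] /=; rewrite FE.
set u := 'd F _ w.
have Hu : has_diff (cmap c \o phi) x v u.
  apply: has_diff_near (has_diff_comp Hphi (has_diffP w dF)).
  by apply: filterS (filterI n1 n2) => z [z1 z2] /=; rewrite FE.
have Hd := has_diffP u (incl_differentiable dphi).
have := has_diff_comp Hu Hd.
move=> /(@has_diff_near _ _ _ _ (fun z => set_val (phi z) : 'rV[R]_d)) H.
suff /H/(has_diff_uniq Hphi) -> : \forall y \near x,
  ((fun y => set_val (cinv c y)) \o (cmap c \o phi)) y = set_val (phi y) by [].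
by apply: filterS n1 => z cz /=; rewrite cK.
Qed.

(** The ambient extension [F] of the chart map is a local left inverse of the inclusion, so its
    differential inverts that of the inclusion on the left. *)
Lemma subchart_immersion (x : S) (u u' : 'rV[R]_n) : cdom c x ->
  'd (fun y => set_val (cinv c y) : 'rV[R]_d) (cmap c x) u =
  'd (fun y => set_val (cinv c y) : 'rV[R]_d) (cmap c x) u' -> u = u'.
Proof.
move=> cx; have [oc oi cK _ ci] := chartc.
have [_ _ /(_ _ cx) [Q [F [oO Ox sF FE]]]] := hc.
have ix : cimg c (cmap c x) by exists x.
have n1 : \forall y \near cmap c x, cimg c y by exact: open_nbhs_nbhs.
have n2 : \forall y \near cmap c x, Q (set_val (cinv c y)).
  by apply: near_set_val => //; [exact: ci|rewrite cK].
have dF : differentiable F (set_val (cinv c (cmap c x)) : 'rV[R]_d).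
  by rewrite cK //; exact: smooth_on_differentiable sF Ox.
have H v : 'd F (set_val (cinv c (cmap c x)) : 'rV[R]_d)
    ('d (fun y => set_val (cinv c y) : 'rV[R]_d) (cmap c x) v) = v.
  have H1 := has_diffP v (incl_differentiable cx).
  have := has_diff_comp H1 (has_diffP _ dF).
  move=> /(@has_diff_near _ _ _ _ id) H2.
  suff /H2 H3 : \forall y \near cmap c x,
    (F \o (fun y => set_val (cinv c y) : 'rV[R]_d)) y = id y.
    exact: has_diff_uniq H3 (has_diff_id _ _).
  apply: filterS (filterI n1 n2) => y [iy Oy] /=.
  by have [dy yE] := chart_cinv chartc iy; rewrite -FE.
by move=> E; rewrite -(H u) E H.
Qed.

End Subchart.

(** Any two subcharts are automatically compatible by [subchart_comp_smooth]; only a covering family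
    has to be supplied. *)
Lemma sub_mfd_is_manifold d n (S : set 'rV[R]_d) :
  (forall x : S, exists2 c : chart R S n, is_subchart c & cdom c x) ->
  is_manifold (sub_mfd n S).
Proof.
move=> Scov; split.
- apply: (@inj_hausdorff _ _ (set_val : S -> 'rV[R]_d)).
  + exact: set_val_continuous.
  + exact: val_inj.
  + exact: norm_hausdorff.
- apply: (@embedded_second_countable _ _ (set_val : S -> 'rV[R]_d)).
  + exact: set_val_continuous.
  + by move=> x A; exact: set_val_nbhs.
  + exact: rV_second_countable.
- by move=> [c hc] /=; have [] := hc.
- by move=> x; have [c hc cx] := Scov x; exists (exist _ c hc).
- move=> [c hc] [c' hc'] /=.
  have [chc _ _] := hc; have [chc' _ _] := hc'.
  have [oc _ cK _ ci] := chc; have [oc' _ _ _ _] := chc'.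
  apply: subchart_comp_smooth => //.
  + by apply: chart_img_open.
  + by move=> _ [x [cx _] <-]; apply: ci; exists x.
  + by move=> _ [x [cx cx'] <-]; rewrite cK.
  + move=> k; apply: sub_Ck_on (incl_smooth hc k).
    by move=> _ [x [cx _] <-]; exists x.
Qed.

Lemma smooth_to_sub_mfd (M : charted R) d n (S : set 'rV[R]_d)
    (f : M -> sub_mfd n S) :
  (forall i, is_chart (@mchart R M i)) -> continuous f ->
  (forall i, smooth_on (cimg (@mchart R M i))
     (fun y => set_val (f (cinv (mchart i) y)) : 'rV[R]_d)) ->
  smooth f.
Proof.
move=> Mch cf sf; split => // i [c hc] /=.
have hi := Mch i; have [oi _ iK _ ci] := hi.
have [[oc _ _ _ _] _ _] := hc.
have sub : cmap (mchart i) @` (cdom (mchart i) `&` f @^-1` cdom c) `<=` cimg (mchart i).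
  by move=> _ [x [dx _] <-]; exists x.
rewrite -compA; apply: subchart_comp_smooth => //.
- by apply: chart_img_open => //; move/continuousP: cf; exact.
- move=> y /sub iy; apply: continuous_comp; first exact: ci.
  exact: cf.
- by move=> _ [x [dx fx] <-] /=; rewrite iK.
- by move=> k; apply: sub_Ck_on (sf i k).
Qed.

Lemma prod_is_chart (S T : topologicalType) m n (c : chart R S m)
    (d : chart R T n) : is_chart c -> is_chart d -> is_chart (prod_chart c d).
Proof.
move=> hc hd; have [oc oic cK cc cic] := hc; have [od oid dK cd cid] := hd.
have cl : continuous (lsubmx : 'rV[R]_(m + n) -> 'rV[R]_m).
  move=> v; apply: continuous_mx => i j.
  have -> : (fun y : 'rV[R]_(m + n) => lsubmx y i j) = (fun y => y i (lshift n j)).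
    by apply/funext => y; rewrite mxE.
  exact: coord_continuous.
have cr : continuous (rsubmx : 'rV[R]_(m + n) -> 'rV[R]_n).
  move=> v; apply: continuous_mx => i j.
  have -> : (fun y : 'rV[R]_(m + n) => rsubmx y i j) = (fun y => y i (rshift m j)).
    by apply/funext => y; rewrite mxE.
  exact: coord_continuous.
have imgE : cimg (prod_chart c d) = lsubmx @^-1` cimg c `&` rsubmx @^-1` cimg d.
  apply/seteqP; split => [_ [[x y] [/= dx dy] <-]|v [[x dx xE] [y dy yE]]] /=.
    by split; rewrite /= ?row_mxKl ?row_mxKr; [exists x|exists y].
  by exists (x, y) => //=; rewrite xE yE hsubmxK.
split.
- apply: open_nearP => -[x y] [/= dx dy].
  by exists (cdom c, cdom d) => //=; split; exact: open_nbhs_nbhs.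
- rewrite imgE; apply: openI.
    by move/continuousP: cl; exact.
  by move/continuousP: cr; exact.
- by move=> [x y] [/= dx dy]; rewrite row_mxKl row_mxKr cK // dK.
- move=> [x y] [/= dx dy]; apply: continuous_mx => i j.
  rewrite (_ : (fun y0 : S * T => _) = fun z : S * T =>
     match fintype.split j with inl k => cmap c z.1 i k | inr k => cmap d z.2 i k end); last first.
    by apply/funext => z; rewrite mxE.
  case: (fintype.split j) => k.
    apply: (@continuous_comp _ _ _ (fun z : S * T => cmap c z.1) (fun M : 'rV[R]_m => M i k)).
      by apply: continuous_comp; [exact: cvg_fst|exact: cc].
    exact: coord_continuous.
  apply: (@continuous_comp _ _ _ (fun z : S * T => cmap d z.2) (fun M : 'rV[R]_n => M i k)).
    by apply: continuous_comp; [exact: cvg_snd|exact: cd].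
  exact: coord_continuous.
- move=> v; rewrite imgE => -[/= v1 v2].
  have H1 : {for v, continuous (fun z => cinv c (lsubmx z))}.
    by apply: (@continuous_comp _ _ _ lsubmx (cinv c)); [exact: cl|exact: cic].
  have H2 : {for v, continuous (fun z => cinv d (rsubmx z))}.
    by apply: (@continuous_comp _ _ _ rsubmx (cinv d)); [exact: cr|exact: cid].
  exact: (cvg_pair H1 H2).
Qed.

End Charts.

(** * Smoothness rules and the charts of G and N *)

Section SmoothRules.
Variables (R : realType).
Implicit Types V W : normedModType R.

Lemma smooth_cst V W (A : set V) (a : W) : smooth_on A (fun _ => a).
Proof. by move=> k; exact: Ck_on_cst. Qed.

Lemma smooth_add V W (A : set V) (f g : V -> W) : open A ->
  smooth_on A f -> smooth_on A g -> smooth_on A (fun x => f x + g x).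
Proof. by move=> oA Cf Cg k; exact: Ck_onD. Qed.

Lemma smooth_opp V W (A : set V) (f : V -> W) : open A ->
  smooth_on A f -> smooth_on A (fun x => - f x).
Proof. by move=> oA Cf k; exact: Ck_onN. Qed.

Lemma smooth_mul V (A : set V) (f g : V -> R) : open A ->
  smooth_on A f -> smooth_on A g -> smooth_on A (fun x => f x * g x).
Proof. by move=> oA Cf Cg k; exact: Ck_onM. Qed.

Lemma smooth_sin V (A : set V) (f : V -> R) : open A ->
  smooth_on A f -> smooth_on A (fun x => sin (f x)).
Proof.
move=> oA Cf k.
exact: (Ck_on_compR oA (B := setT) (fun _ _ => I) (Cf k) (Ck_on_sincos k setT).1).
Qed.

Lemma smooth_cos V (A : set V) (f : V -> R) : open A ->
  smooth_on A f -> smooth_on A (fun x => cos (f x)).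
Proof.
move=> oA Cf k.
exact: (Ck_on_compR oA (B := setT) (fun _ _ => I) (Cf k) (Ck_on_sincos k setT).2).
Qed.

Lemma smooth_inv V (A : set V) (f : V -> R) : open A ->
  (forall x, A x -> f x != 0) ->
  smooth_on A f -> smooth_on A (fun x => (f x)^-1).
Proof.
by move=> oA f0 Cf k; exact: (Ck_on_compR oA f0 (Cf k) (@Ck_on_inv R k)).
Qed.

Lemma smooth_entry V (A : set V) m n (f : V -> 'M[R]_(m, n)) i j : open A ->
  smooth_on A f -> smooth_on A (fun x => f x i j).
Proof. by move=> oA Cf k; exact: Ck_on_coord. Qed.

Lemma smooth_mx V (A : set V) m n (f : V -> 'M[R]_(m, n)) : open A ->
  (forall i j, smooth_on A (fun x => f x i j)) -> smooth_on A f.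
Proof. by move=> oA Cf k; apply: Ck_on_mx => // i j; exact: Cf. Qed.

Lemma smooth_id V (A : set V) : smooth_on A (fun x : V => x).
Proof. by move=> k; apply: (@Ck_on_lin _ _ _ _ _ idfun) => x; exact: cvg_id. Qed.

Lemma smooth_coord m n (A : set 'M[R]_(m, n)) i j : open A ->
  smooth_on A (fun x : 'M[R]_(m, n) => x i j).
Proof. by move=> oA; apply: (smooth_entry i j oA); exact: smooth_id. Qed.

Lemma eq_smooth V W (A : set V) (f g : V -> W) : open A ->
  (forall x, A x -> f x = g x) -> smooth_on A f -> smooth_on A g.
Proof. by move=> oA fg Cf k; exact: eq_Ck_on fg (Cf k). Qed.

Lemma sub_smooth V W (A B : set V) (f : V -> W) :
  A `<=` B -> smooth_on B f -> smooth_on A f.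
Proof. by move=> AB Cf k; exact: sub_Ck_on (Cf k). Qed.

Lemma smooth_lsub (n p : nat) (A : set 'rV[R]_(n + p)) i j : open A ->
  smooth_on A (fun x : 'rV[R]_(n + p) => lsubmx x i j).
Proof.
move=> oA; apply: (eq_smooth oA _ (smooth_coord i (lshift p j) oA)) => x _.
by rewrite mxE.
Qed.

Lemma smooth_rsub (n p : nat) (A : set 'rV[R]_(n + p)) i j : open A ->
  smooth_on A (fun x : 'rV[R]_(n + p) => rsubmx x i j).
Proof.
move=> oA; apply: (eq_smooth oA _ (smooth_coord i (rshift n j) oA)) => x _.
by rewrite mxE.
Qed.

Lemma smooth_row V (A : set V) n (s : V -> seq R) : open A ->
  (forall j, (j < n)%N -> smooth_on A (fun x => nth 0 (s x) j)) ->
  smooth_on A (fun x => \row_(k < n) nth 0 (s x) k).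
Proof.
move=> oA Cs; apply: smooth_mx => // i j.
by apply: (eq_smooth oA _ (Cs j (ltn_ord j))) => x _; rewrite mxE.
Qed.

Lemma smooth_continuous V W (A : set V) (f : V -> W) x :
  smooth_on A f -> A x -> {for x, continuous f}.
Proof. by move=> /(_ 0%N); apply. Qed.

End SmoothRules.

Ltac smooth_tac :=
  repeat first
    [ exact: openT | assumption | exact: smooth_cst
    | apply: smooth_add | apply: smooth_opp | apply: smooth_mul
    | apply: smooth_sin | apply: smooth_cos
    | apply: smooth_lsub | apply: smooth_rsub | apply: smooth_coord ].

(** * Manifolds with a single global chart *)

Section GlobalChart.
Variables (R : realType) (M : charted R) (i0 : mindex M).
Hypotheses (M1 : forall i, i = i0) (hM : is_chart (mchart i0))
  (dM : cdom (mchart i0) = setT) (iM : cimg (mchart i0) = setT).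

Lemma global_cmapK : cancel (cmap (mchart i0)) (cinv (mchart i0)).
Proof. by move=> x; have [_ _ cK _ _] := hM; rewrite cK ?dM. Qed.

Lemma global_cmap_continuous : continuous (cmap (mchart i0)).
Proof. by move=> x; have [_ _ _ cc _] := hM; apply: cc; rewrite dM. Qed.

Lemma global_cinv_continuous : continuous (cinv (mchart i0)).
Proof. by move=> x; have [_ _ _ _ cc] := hM; apply: cc; rewrite iM. Qed.

Lemma global_chart_manifold : is_manifold M.
Proof.
split.
- apply: (inj_hausdorff global_cmap_continuous); last exact: norm_hausdorff.
  exact: can_inj global_cmapK.
- apply: (embedded_second_countable global_cmap_continuous).
    exact: continuous_cancel_nbhs global_cinv_continuous global_cmapK.
  exact: rV_second_countable.
- by move=> i; rewrite (M1 i).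
- by move=> x; exists i0; rewrite dM.
- move=> i j; rewrite (M1 i) (M1 j) /= setIid.
  have -> : cmap (mchart i0) @` cdom (mchart i0) = setT by exact: iM.
  apply: (eq_smooth openT _ (@smooth_id _ _ _)) => x _ /=.
  have ix : cimg (mchart i0) x by rewrite iM.
  by have [_ ->] := chart_cinv hM ix.
Qed.

(** Both global charts are homeomorphisms, so the continuity of [f] is recovered from that of its
    coordinate expression. *)
Lemma smooth_to_global (L : charted R) (l0 : mindex L) (f : L -> M) :
  (forall l, l = l0) -> is_chart (mchart l0) ->
  cdom (mchart l0) = setT -> cimg (mchart l0) = setT ->
  smooth_on setT (cmap (mchart i0) \o f \o cinv (mchart l0)) ->
  smooth f.
Proof.
move=> L1 hL dL iL sf.
have [_ _ lK lc _] := hL.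
have fE : f = cinv (mchart i0) \o
    ((cmap (mchart i0) \o f \o cinv (mchart l0)) \o cmap (mchart l0)).
  by apply/funext => x /=; rewrite lK ?dL // global_cmapK.
split; last by move=> l j; rewrite (L1 l) (M1 j) /=; exact: sub_smooth sf.
rewrite fE => x; apply: continuous_comp; last exact: global_cinv_continuous.
apply: continuous_comp; first by apply: lc; rewrite dL.
exact: smooth_continuous sf _.
Qed.

End GlobalChart.

(** * The matrix coordinates of G and N as charts *)

Section Groups.
Variable R : realType.
Notation C := (R[i]%C : numFieldType).

Lemma continuous_Complex (T : topologicalType) (f g : T -> R) (x : T) :
  {for x, continuous f} -> {for x, continuous g} ->
  {for x, continuous (fun y => (f y +i* g y)%C : C)}.
Proof.
move=> cf cg; apply/cvgrPdist_lt => e e0.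
(* The norm of [R[i]] takes values in [R[i]], so [e] is complex; being positive in the partial order
   forces it to be real. *)
have [ei er] : complex.Im e = 0 /\ 0 < complex.Re e.
  by move: e0; rewrite ltcE => /andP[/eqP].
have e2 : 0 < complex.Re e / 2 by rewrite divr_gt0.
have n1 : \forall y \near x, `|f x - f y| < complex.Re e / 2.
  by move/cvgrPdist_lt: cf; exact.
have n2 : \forall y \near x, `|g x - g y| < complex.Re e / 2.
  by move/cvgrPdist_lt: cg; exact.
apply: filterS (filterI n1 n2) => y [y1 y2].
have -> : (f x +i* g x)%C - (f y +i* g y)%C = ((f x - f y)%:C + 'i * (g x - g y)%:C)%C :> R[i].
  by apply/eqP; rewrite eq_complex /= !mul0r !mul1r !subr0 !addr0 !add0r !eqxx.
apply: le_lt_trans (ler_normD _ _) _.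
rewrite normrM !normc_def /= expr0n /= expr1n !addr0 !add0r sqrtr1 mul1r !sqrtr_sqr.
rewrite ltcE /= ei addr0 eqxx /= [ltRHS]splitr.
exact: ltrD.
Qed.

Lemma continuous_Re : continuous (@complex.Re R : C -> R).
Proof.
move=> z A /nbhs_ballP[e /= e0 eA].
have e0C : 0 < e%:C%C by rewrite ltcR.
have nB : nbhs (z : C) (ball (z : C) e%:C%C) by apply/nbhs_ballP; exists e%:C%C.
suff : nbhs (z : C) ((@complex.Re R : C -> R) @^-1` A) by [].
apply: filterS nB => y; rewrite -ball_normE /= => H.
apply: eA; rewrite -ball_normE /=.
by rewrite -ltcR; apply: le_lt_trans H; rewrite -raddfB; exact: normc_ge_Re.
Qed.

Lemma continuous_Im : continuous (@complex.Im R : C -> R).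
Proof.
move=> z A /nbhs_ballP[e /= e0 eA].
have e0C : 0 < e%:C%C by rewrite ltcR.
have nB : nbhs (z : C) (ball (z : C) e%:C%C) by apply/nbhs_ballP; exists e%:C%C.
suff : nbhs (z : C) ((@complex.Im R : C -> R) @^-1` A) by [].
apply: filterS nB => y; rewrite -ball_normE /= => H.
apply: eA; rewrite -ball_normE /=.
rewrite -ltcR; apply: le_lt_trans H.
rewrite -raddfB normc_def lecR -sqrtr_sqr ler_wsqrtr // lerDr.
exact: sqr_ge0.
Qed.

Definition gG (a : R) (b : R[i]) (c e f : R) : GG R := mkG (Gset_gmx a b c e f).
Definition nN (a : R) (b : R[i]) (f : R) : NN R := mkN (Nset_gmx a b f).

Lemma gG_case (g : GG R) : exists a b c e f, g = gG a b c e f.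
Proof.
have [a [b [c [e [f E]]]]] := set_valP (g : @Gset R).
by exists a, b, c, e, f; apply: val_inj.
Qed.

Lemma nN_case (g : NN R) : exists a b f, g = nN a b f.
Proof.
have [a [b [f E]]] := set_valP (g : @Nset R).
by exists a, b, f; apply: val_inj.
Qed.

Lemma gG_mul a b c e f a' b' c' e' f' :
  lg_mul (gG a b c e f) (gG a' b' c' e' f') =
  gG (a + a') (b + expj a * b') (c + c') (e + e') (f + f' + c * e' + e * a').
Proof. by apply: val_inj; exact: gmx_mul. Qed.

Lemma nN_mul a b f a' b' f' :
  lg_mul (nN a b f) (nN a' b' f') = nN (a + a') (b + expj a * b') (f + f').
Proof.
by apply: val_inj; rewrite /= gmx_mul !mul0r !addr0.
Qed.

Lemma gG_inv a b c e f : lg_inv (gG a b c e f) =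
  gG (- a) (- (expj (- a) * b)) (- c) (- e) (- f + c * e + e * a).
Proof. by apply: val_inj; exact: gmx_inv. Qed.

Lemma nN_inv a b f : lg_inv (nN a b f) = nN (- a) (- (expj (- a) * b)) (- f).
Proof. by apply: val_inj; rewrite /= gmx_inv !mul0r !addr0 oppr0. Qed.

Lemma gG_one : lg_one (GG R) = gG 0 0 0 0 0.
Proof. by apply: val_inj; rewrite /= gmx1. Qed.

Lemma nN_one : lg_one (NN R) = nN 0 0 0.
Proof. by apply: val_inj; rewrite /= gmx1. Qed.

Lemma N_inclE a b f : N_incl (nN a b f) = gG a b 0 0 f.
Proof. exact: val_inj. Qed.

Lemma cmapG a b c e f : cmap (@G_chart R) (gG a b c e f) =
  \row_(k < 6) nth 0 [:: a; complex.Re b; complex.Im b; c; e; f] k.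
Proof. by apply/rowP => k; rewrite !mxE. Qed.

Lemma cmapN a b f : cmap (@N_chart R) (nN a b f) =
  \row_(k < 4) nth 0 [:: a; complex.Re b; complex.Im b; f] k.
Proof. by apply/rowP => k; rewrite !mxE. Qed.

Lemma rV_inord n (v : 'rV[R]_n.+1) : v = \row_(k < n.+1) v 0 (inord k).
Proof. by apply/rowP => k; rewrite mxE inord_val. Qed.

Lemma G_chartK : cancel (cmap (@G_chart R)) (cinv (@G_chart R)).
Proof.
move=> g; have [a [b [c [e [f ->]]]]] := gG_case g.
rewrite cmapG; apply: val_inj; rewrite /= !mxE !inordK //=.
by case: b.
Qed.

Lemma G_cinvK : cancel (cinv (@G_chart R)) (cmap (@G_chart R)).
Proof.
move=> v; rewrite [RHS]rV_inord; apply/rowP => k; rewrite !mxE.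
by case: k => [[|[|[|[|[|[|k]]]]]] hk].
Qed.

Lemma N_chartK : cancel (cmap (@N_chart R)) (cinv (@N_chart R)).
Proof.
move=> g; have [a [b [f ->]]] := nN_case g.
rewrite cmapN; apply: val_inj; rewrite /= !mxE !inordK //=.
by case: b.
Qed.

Lemma N_cinvK : cancel (cinv (@N_chart R)) (cmap (@N_chart R)).
Proof.
move=> v; rewrite [RHS]rV_inord; apply/rowP => k; rewrite !mxE.
by case: k => [[|[|[|[|k]]]] hk].
Qed.

Lemma gmx_continuous (T : topologicalType) (a b1 b2 c e f : T -> R) (x : T) :
  {for x, continuous a} -> {for x, continuous b1} -> {for x, continuous b2} ->
  {for x, continuous c} -> {for x, continuous e} -> {for x, continuous f} ->
  {for x, continuous (fun y => gmx (a y) (b1 y +i* b2 y)%C (c y) (e y) (f y))}.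
Proof.
move=> ca cb1 cb2 cc ce cf; apply: continuous_mx => k l.
(* The 25 entries are of only seven kinds, and abstracting the property lets each kind be treated
   once. *)
have H (P : (T -> C) -> Prop) : (forall z, P (fun _ => z)) ->
    P (fun y => (a y)%:C%C) -> P (fun y => (c y)%:C%C) -> P (fun y => (e y)%:C%C) ->
    P (fun y => (f y)%:C%C) -> P (fun y => expj (a y)) ->
    P (fun y => (b1 y +i* b2 y)%C) ->
    P (fun y => gmx (a y) (b1 y +i* b2 y)%C (c y) (e y) (f y) k l).
  move=> HC Ha Hc He Hf HE HX.
  rewrite (_ : (fun y => _) = fun y => nth 0 (nth [::]
    [:: [:: 1; (c y)%:C%C; 0;      (e y)%:C%C; (f y)%:C%C];
        [:: 0; 1;      0;      0;      (e y)%:C%C];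
        [:: 0; 0;      expj (a y); 0;      (b1 y +i* b2 y)%C     ];
        [:: 0; 0;      0;      1;      (a y)%:C%C];
        [:: 0; 0;      0;      0;      1     ] ] k) l : C); last first.
    by apply/funext => y; rewrite mxE.
  by case: k => [[|[|[|[|[|k]]]]] hk] //=; case: l => [[|[|[|[|[|l]]]]] hl] //=.
have cR (h : T -> R) : {for x, continuous h} ->
    {for x, continuous (fun y => (h y)%:C%C : C)}.
  by move=> ch; apply: continuous_Complex => //; exact: cst_continuous.
have c2 : {for x, continuous (fun y => 2 * pi * a y)}.
  by apply: continuousM; [exact: cst_continuous|exact: ca].
apply: (H (fun h => {for x, continuous h})).
- by move=> z; exact: cst_continuous.
- exact: cR.
- exact: cR.
- exact: cR.
- exact: cR.
- apply: continuous_Complex.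
    by apply: (@continuous_comp _ _ _ _ cos); [exact: c2|exact: continuous_cos].
  by apply: (@continuous_comp _ _ _ _ sin); [exact: c2|exact: continuous_sin].
- exact: continuous_Complex.
Qed.

Lemma G_is_chart : is_chart (@G_chart R).
Proof.
have iT : cimg (@G_chart R) = setT.
  apply/seteqP; split => // v _.
  by exists (cinv (@G_chart R) v) => //; rewrite G_cinvK.
split.
- exact: openT.
- by rewrite iT; exact: openT.
- by move=> g _; exact: G_chartK.
- move=> g _; apply: continuous_mx => i j.
  have cRe k l : {for g, continuous (fun g : @Gset R => complex.Re (set_val g k l : C))}.
    apply: continuous_comp; last exact: continuous_Re.
    apply: (@continuous_comp _ _ _ (set_val : @Gset R -> 'M[C]_5) (fun M => M k l)).
      exact: set_val_continuous.
    exact: coord_continuous.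
  have cIm k l : {for g, continuous (fun g : @Gset R => complex.Im (set_val g k l : C))}.
    apply: continuous_comp; last exact: continuous_Im.
    apply: (@continuous_comp _ _ _ (set_val : @Gset R -> 'M[C]_5) (fun M => M k l)).
      exact: set_val_continuous.
    exact: coord_continuous.
  rewrite (_ : (fun y => _) = fun y : @Gset R => nth 0
    [:: complex.Re (set_val y (@Ordinal 5 3 isT) (@Ordinal 5 4 isT));
        complex.Re (set_val y (@Ordinal 5 2 isT) (@Ordinal 5 4 isT));
        complex.Im (set_val y (@Ordinal 5 2 isT) (@Ordinal 5 4 isT));
        complex.Re (set_val y (@Ordinal 5 0 isT) (@Ordinal 5 1 isT));
        complex.Re (set_val y (@Ordinal 5 0 isT) (@Ordinal 5 3 isT));
        complex.Re (set_val y (@Ordinal 5 0 isT) (@Ordinal 5 4 isT))] j); last first.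
    by apply/funext => y; rewrite mxE.
  by case: j => [[|[|[|[|[|[|j]]]]]] hj]; [exact: cRe|exact: cRe|exact: cIm|exact: cRe|exact: cRe|exact: cRe|].
- move=> v _; apply: continuous_set_val.
  by apply: gmx_continuous; exact: coord_continuous.
Qed.

Lemma N_is_chart : is_chart (@N_chart R).
Proof.
have iT : cimg (@N_chart R) = setT.
  apply/seteqP; split => // v _.
  by exists (cinv (@N_chart R) v) => //; rewrite N_cinvK.
split.
- exact: openT.
- by rewrite iT; exact: openT.
- by move=> g _; exact: N_chartK.
- move=> g _; apply: continuous_mx => i j.
  have cRe k l : {for g, continuous (fun g : @Nset R => complex.Re (set_val g k l : C))}.
    apply: continuous_comp; last exact: continuous_Re.
    apply: (@continuous_comp _ _ _ (set_val : @Nset R -> 'M[C]_5) (fun M => M k l)).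
      exact: set_val_continuous.
    exact: coord_continuous.
  have cIm k l : {for g, continuous (fun g : @Nset R => complex.Im (set_val g k l : C))}.
    apply: continuous_comp; last exact: continuous_Im.
    apply: (@continuous_comp _ _ _ (set_val : @Nset R -> 'M[C]_5) (fun M => M k l)).
      exact: set_val_continuous.
    exact: coord_continuous.
  rewrite (_ : (fun y => _) = fun y : @Nset R => nth 0
    [:: complex.Re (set_val y (@Ordinal 5 3 isT) (@Ordinal 5 4 isT));
        complex.Re (set_val y (@Ordinal 5 2 isT) (@Ordinal 5 4 isT));
        complex.Im (set_val y (@Ordinal 5 2 isT) (@Ordinal 5 4 isT));
        complex.Re (set_val y (@Ordinal 5 0 isT) (@Ordinal 5 4 isT))] j); last first.
    by apply/funext => y; rewrite mxE.
  by case: j => [[|[|[|[|j]]]] hj]; [exact: cRe|exact: cRe|exact: cIm|exact: cRe|].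
- move=> v _; apply: continuous_set_val.
  by apply: gmx_continuous; first [exact: coord_continuous|exact: cst_continuous].
Qed.

End Groups.

(** * The Lie groups G and N *)

Section LieGroups.
Variable R : realType.
Notation C := (R[i]%C : numFieldType).

Lemma cinvG (v : 'rV[R]_6) : cinv (@G_chart R) v =
  gG (v 0 (inord 0)) (v 0 (inord 1) +i* v 0 (inord 2))%C (v 0 (inord 3))
     (v 0 (inord 4)) (v 0 (inord 5)).
Proof. by []. Qed.

Lemma cinvN (v : 'rV[R]_4) : cinv (@N_chart R) v =
  nN (v 0 (inord 0)) (v 0 (inord 1) +i* v 0 (inord 2))%C (v 0 (inord 3)).
Proof. by []. Qed.

Lemma cimg_full (T : topologicalType) n (c : chart R T n) :
  cdom c = setT -> cancel (cinv c) (cmap c) -> cimg c = setT.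
Proof.
move=> dT cK; apply/seteqP; split => // v _.
by exists (cinv c v); [rewrite dT|rewrite cK].
Qed.

Lemma G_cimg : cimg (@G_chart R) = setT.
Proof. by apply: cimg_full => //; exact: G_cinvK. Qed.

Lemma N_cimg : cimg (@N_chart R) = setT.
Proof. by apply: cimg_full => //; exact: N_cinvK. Qed.

Lemma prod_cimg (S T : topologicalType) m n (c : chart R S m) (d : chart R T n) :
  cdom c = setT -> cdom d = setT ->
  cancel (cinv c) (cmap c) -> cancel (cinv d) (cmap d) ->
  cimg (prod_chart c d) = setT.
Proof.
move=> cT dT cK dK; apply: cimg_full => [|v] /=; first by rewrite cT dT setXTT.
by rewrite cK dK hsubmxK.
Qed.

Lemma unit_tt (i : unit) : i = tt. Proof. by case: i. Qed.

Lemma G_manifold : is_manifold (GG R).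
Proof.
exact: (@global_chart_manifold _ (GG R) tt unit_tt (G_is_chart R) erefl G_cimg).
Qed.

Lemma N_manifold : is_manifold (NN R).
Proof.
exact: (@global_chart_manifold _ (NN R) tt unit_tt (N_is_chart R) erefl N_cimg).
Qed.

Lemma G_mul_smooth :
  @smooth R (prod_mfd (GG R) (GG R)) (GG R) (fun z => lg_mul z.1 z.2).
Proof.
apply: (@smooth_to_global _ (GG R) tt unit_tt (G_is_chart R) erefl G_cimg
  (prod_mfd (GG R) (GG R)) (tt, tt)).
- by move=> [[] []].
- by apply: prod_is_chart; exact: G_is_chart.
- by rewrite /= setXTT.
- by apply: prod_cimg => //; exact: G_cinvK.
pose l (v : 'rV[R]_(6 + 6)) k := lsubmx v 0 (inord k) : R.
pose r (v : 'rV[R]_(6 + 6)) k := rsubmx v 0 (inord k) : R.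
apply: (@eq_smooth _ _ _ _ (fun v : 'rV[R]_(6 + 6) => \row_(k < 6) nth 0
  [:: l v 0%N + r v 0%N;
      l v 1%N + (cos (2 * pi * l v 0%N) * r v 1%N - sin (2 * pi * l v 0%N) * r v 2);
      l v 2 + (cos (2 * pi * l v 0%N) * r v 2 + sin (2 * pi * l v 0%N) * r v 1%N);
      l v 3 + r v 3; l v 4 + r v 4;
      l v 5 + r v 5 + l v 3 * r v 4 + l v 4 * r v 0%N] k)); first exact: openT.
  move=> v _; rewrite -[RHS]/(cmap (@G_chart R) (@lg_mul R (GG R)
      (cinv (@G_chart R) (lsubmx v)) (cinv (@G_chart R) (rsubmx v)))).
    by rewrite !cinvG gG_mul cmapG.
apply: smooth_row; first exact: openT.
by do 6 (case => [_|]; [rewrite /= /l /r; smooth_tac|]).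
Qed.

Lemma N_mul_smooth :
  @smooth R (prod_mfd (NN R) (NN R)) (NN R) (fun z => lg_mul z.1 z.2).
Proof.
apply: (@smooth_to_global _ (NN R) tt unit_tt (N_is_chart R) erefl N_cimg
  (prod_mfd (NN R) (NN R)) (tt, tt)).
- by move=> [[] []].
- by apply: prod_is_chart; exact: N_is_chart.
- by rewrite /= setXTT.
- by apply: prod_cimg => //; exact: N_cinvK.
pose l (v : 'rV[R]_(4 + 4)) k := lsubmx v 0 (inord k) : R.
pose r (v : 'rV[R]_(4 + 4)) k := rsubmx v 0 (inord k) : R.
apply: (@eq_smooth _ _ _ _ (fun v : 'rV[R]_(4 + 4) => \row_(k < 4) nth 0
  [:: l v 0%N + r v 0%N;
      l v 1%N + (cos (2 * pi * l v 0%N) * r v 1%N - sin (2 * pi * l v 0%N) * r v 2);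
      l v 2 + (cos (2 * pi * l v 0%N) * r v 2 + sin (2 * pi * l v 0%N) * r v 1%N);
      l v 3 + r v 3] k)); first exact: openT.
  move=> v _; rewrite -[RHS]/(cmap (@N_chart R) (@lg_mul R (NN R)
      (cinv (@N_chart R) (lsubmx v)) (cinv (@N_chart R) (rsubmx v)))).
    by rewrite !cinvN nN_mul cmapN.
apply: smooth_row; first exact: openT.
by do 4 (case => [_|]; [rewrite /= /l /r; smooth_tac|]).
Qed.

Lemma G_inv_smooth : smooth (@lg_inv R (GG R)).
Proof.
apply: (@smooth_to_global _ (GG R) tt unit_tt (G_is_chart R) erefl G_cimg
  (GG R) tt _ unit_tt (G_is_chart R) erefl G_cimg).
pose l (v : 'rV[R]_6) k := v 0 (inord k) : R.
apply: (@eq_smooth _ _ _ _ (fun v : 'rV[R]_6 => \row_(k < 6) nth 0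
  [:: - l v 0%N;
      - (cos (2 * pi * - l v 0%N) * l v 1%N - sin (2 * pi * - l v 0%N) * l v 2);
      - (cos (2 * pi * - l v 0%N) * l v 2 + sin (2 * pi * - l v 0%N) * l v 1%N);
      - l v 3; - l v 4;
      - l v 5 + l v 3 * l v 4 + l v 4 * l v 0%N] k)); first exact: openT.
  move=> v _.
    rewrite -[RHS]/(cmap (@G_chart R) (@lg_inv R (GG R) (cinv (@G_chart R) v))).
    by rewrite !cinvG gG_inv cmapG.
apply: smooth_row; first exact: openT.
by do 6 (case => [_|]; [rewrite /= /l; smooth_tac|]).
Qed.

Lemma N_inv_smooth : smooth (@lg_inv R (NN R)).
Proof.
apply: (@smooth_to_global _ (NN R) tt unit_tt (N_is_chart R) erefl N_cimg
  (NN R) tt _ unit_tt (N_is_chart R) erefl N_cimg).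
pose l (v : 'rV[R]_4) k := v 0 (inord k) : R.
apply: (@eq_smooth _ _ _ _ (fun v : 'rV[R]_4 => \row_(k < 4) nth 0
  [:: - l v 0%N;
      - (cos (2 * pi * - l v 0%N) * l v 1%N - sin (2 * pi * - l v 0%N) * l v 2);
      - (cos (2 * pi * - l v 0%N) * l v 2 + sin (2 * pi * - l v 0%N) * l v 1%N);
      - l v 3] k)); first exact: openT.
  move=> v _.
    rewrite -[RHS]/(cmap (@N_chart R) (@lg_inv R (NN R) (cinv (@N_chart R) v))).
    by rewrite !cinvN nN_inv cmapN.
apply: smooth_row; first exact: openT.
by do 4 (case => [_|]; [rewrite /= /l; smooth_tac|]).
Qed.

Lemma G_lie_group : is_lie_group (GG R).
Proof.
split; [exact: G_manifold| |exact: G_mul_smooth|exact: G_inv_smooth|exact: I].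
split=> [x y z|x|x].
- by apply: val_inj; exact: mulmxA.
- by apply: val_inj; exact: mul1mx.
- have [a [b [c [e [f ->]]]]] := gG_case x.
  rewrite gG_inv gG_mul gG_one; congr gG; ring.
Qed.

Lemma N_lie_group : is_lie_group (NN R).
Proof.
split; [exact: N_manifold| |exact: N_mul_smooth|exact: N_inv_smooth|exact: I].
split=> [x y z|x|x].
- by apply: val_inj; exact: mulmxA.
- by apply: val_inj; exact: mul1mx.
- have [a [b [f ->]]] := nN_case x.
  rewrite nN_inv nN_mul nN_one; congr nN; ring.
Qed.

Lemma expj0 : expj (0 : R) = 1.
Proof. by rewrite /expj mulr0 cos0 sin0. Qed.

(** The parameters a, c and e are additive, so commutators lie in a = c = e = 0. There [expj a] is 1
    and the products in the last entry vanish, so these elements commute and the second derived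
    group is trivial. *)
Lemma G_solvable : solvable_group (GG R).
Proof.
exists 2%N; rewrite -[iter _ _ _]/(derived_subgroup (@derived_subgroup R (GG R) setT)).
set D := @derived_subgroup R (GG R) setT.
have DK : D `<=` [set g | exists b f, g = gG 0 b 0 0 f].
  apply: smallest_sub; first split.
  - by exists 0, 0; exact: gG_one.
  - move=> _ _ [b [f ->]] [b' [f' ->]].
    by rewrite gG_mul !addr0; do 2 eexists.
  - move=> _ [b [f ->]].
    by rewrite gG_inv oppr0; do 2 eexists.
  - move=> _ [x _ [y _ <-]].
    have [a [b [c [e [f ->]]]]] := gG_case x.
    have [a' [b' [c' [e' [f' ->]]]]] := gG_case y.
    rewrite !gG_inv !gG_mul.
    rewrite (_ : a + a' + (- a + - a') = 0); last by ring.
    rewrite (_ : c + c' + (- c + - c') = 0); last by ring.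
    rewrite (_ : e + e' + (- e + - e') = 0); last by ring.
    by do 2 eexists.
apply/seteqP; split.
  apply: smallest_sub; first split => //.
  - by move=> _ _ -> ->; rewrite gG_one gG_mul; congr gG; ring.
  - by move=> _ ->; rewrite gG_one gG_inv; congr gG; ring.
  - move=> _ [x /DK[b [f ->]] [y /DK[b' [f' ->]] <-]].
    rewrite !gG_inv !gG_mul gG_one oppr0 addr0 expj0; congr gG; ring.
move=> _ -> A [[A1 _ _] _]; exact: A1.
Qed.

(** [N] is the common kernel of the homomorphisms c and e. *)
Lemma N_normal : is_normal_subgroup (range (@N_incl R)).
Proof.
split; first split.
- by exists (lg_one (NN R)) => //; exact: val_inj.
- by move=> _ _ [x _ <-] [y _ <-]; exists (lg_mul x y) => //; exact: val_inj.
- by move=> _ [x _ <-]; exists (lg_inv x) => //; exact: val_inj.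
move=> g _ [x _ <-].
have [a [b [f ->]]] := nN_case x.
have [a' [b' [c' [e' [f' ->]]]]] := gG_case g.
rewrite N_inclE gG_inv !gG_mul.
rewrite (_ : c' + 0 + - c' = 0); last by ring.
rewrite (_ : e' + 0 + - e' = 0); last by ring.
by rewrite -N_inclE; exact: imageT.
Qed.

End LieGroups.

(** * Adjoint and coadjoint actions *)

Ltac has_diff_tac :=
  repeat first
    [ apply: has_diff_cst | apply: has_diffD | apply: has_diffN | apply: has_diffM
    | apply: has_diff_sin | apply: has_diff_cos | apply: has_diff_coord ].

Section Coadjoint.
Variable R : realType.

Lemma has_diff_row (V : normedModType R) n (s : V -> seq R) (t : seq R) (x v : V) :
  (forall j, (j < n)%N -> has_diff (fun y => nth 0 (s y) j) x v (nth 0 t j)) ->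
  has_diff (fun y => \row_(k < n) nth 0 (s y) k) x v (\row_(k < n) nth 0 t k).
Proof.
move=> H; apply: has_diff_mx => i j; rewrite mxE.
rewrite (_ : (fun y => _) = fun y => nth 0 (s y) j); first exact: H.
by apply/funext => y; rewrite mxE.
Qed.

(** The derivative at the identity of the conjugation formula [G_conj]. There is no parameter f
    because the corresponding subgroup is central. *)
Definition G_Ad (a b1 b2 c e : R) (xi : 'rV[R]_6) : 'rV[R]_6 :=
  let x k := xi 0 (inord k) in
  \row_(k < 6) nth 0 [:: x 0%N;
    cos (2 * pi * a) * x 1%N - sin (2 * pi * a) * x 2%N + 2 * pi * x 0%N * b2;
    cos (2 * pi * a) * x 2%N + sin (2 * pi * a) * x 1%N - 2 * pi * x 0%N * b1;
    x 3%N; x 4%N; x 5%N + c * x 4%N + e * x 0%N - e * x 3%N - a * x 4%N] k.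

Definition N_Ad (a b1 b2 : R) (xi : 'rV[R]_4) : 'rV[R]_4 :=
  let x k := xi 0 (inord k) in
  \row_(k < 4) nth 0 [:: x 0%N;
    cos (2 * pi * a) * x 1%N - sin (2 * pi * a) * x 2%N + 2 * pi * x 0%N * b2;
    cos (2 * pi * a) * x 2%N + sin (2 * pi * a) * x 1%N - 2 * pi * x 0%N * b1;
    x 3%N] k.

Lemma rV0E n (k : 'I_n) : (0 : 'rV[R]_n) 0 k = 0.
Proof. by rewrite mxE. Qed.

Lemma cmapG_one : cmap (@G_chart R) (lg_one (GG R)) = 0.
Proof.
rewrite gG_one cmapG; apply/rowP => k; rewrite !mxE.
by case: k => [[|[|[|[|[|[|k]]]]]] hk].
Qed.

Lemma cmapN_one : cmap (@N_chart R) (lg_one (NN R)) = 0.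
Proof.
rewrite nN_one cmapN; apply/rowP => k; rewrite !mxE.
by case: k => [[|[|[|[|k]]]] hk].
Qed.

Lemma expj_complex (a x y : R) : expj a * (x +i* y)%C =
  ((cos (2 * pi * a) * x - sin (2 * pi * a) * y) +i*
   (cos (2 * pi * a) * y + sin (2 * pi * a) * x))%C.
Proof. by []. Qed.

Lemma expjN_mul (a : R) (b : R[i]) : expj a * (expj (- a) * b) = b.
Proof. by rewrite mulrA -expjD subrr expj0 mul1r. Qed.

Lemma G_conj a b c e f a' b' c' e' f' :
  lg_mul (lg_mul (gG a b c e f) (gG a' b' c' e' f')) (lg_inv (gG a b c e f)) =
  @gG R a' (b + expj a * b' - expj a' * b) c' e'
     (f' + c * e' + e * a' - e * c' - a * e').
Proof.
rewrite gG_inv !gG_mul; congr gG; try ring.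
by rewrite mulrN [a + a']addrC expjD -mulrA expjN_mul.
Qed.

Lemma N_conj a b f a' b' f' :
  lg_mul (lg_mul (nN a b f) (nN a' b' f')) (lg_inv (nN a b f)) =
  @nN R a' (b + expj a * b' - expj a' * b) f'.
Proof.
rewrite nN_inv !nN_mul; congr nN; try ring.
by rewrite mulrN [a + a']addrC expjD -mulrA expjN_mul.
Qed.

Lemma AdG a b1 b2 c e f xi :
  Ad (gG a (b1 +i* b2)%C c e f) xi = G_Ad a b1 b2 c e xi.
Proof.
rewrite /Ad /tmap.
suff [_ ->] : has_diff (cmap (mchart (lg_chart (GG R))) \o
    (fun h : GG R => lg_mul (lg_mul (gG a (b1 +i* b2)%C c e f) h)
       (lg_inv (gG a (b1 +i* b2)%C c e f))) \o cinv (mchart (lg_chart (GG R))))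
    (cmap (mchart (lg_chart (GG R))) (lg_one (GG R))) xi (G_Ad a b1 b2 c e xi) by [].
rewrite [cmap _ _]cmapG_one.
rewrite (_ : _ \o _ = fun v : 'rV[R]_6 => \row_(k < 6) nth 0 [:: v 0 (inord 0);
   b1 + (cos (2 * pi * a) * v 0 (inord 1) - sin (2 * pi * a) * v 0 (inord 2))
    - (cos (2 * pi * v 0 (inord 0)) * b1 - sin (2 * pi * v 0 (inord 0)) * b2);
   b2 + (cos (2 * pi * a) * v 0 (inord 2) + sin (2 * pi * a) * v 0 (inord 1))
    - (cos (2 * pi * v 0 (inord 0)) * b2 + sin (2 * pi * v 0 (inord 0)) * b1);
   v 0 (inord 3); v 0 (inord 4);
   v 0 (inord 5) + c * v 0 (inord 4) + e * v 0 (inord 0) - e * v 0 (inord 3)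
   - a * v 0 (inord 4)] k); last first.
  apply/funext => v.
  rewrite -[LHS]/(cmap (@G_chart R) (@lg_mul R (GG R)
    (@lg_mul R (GG R) (gG a (b1 +i* b2)%C c e f) (cinv (@G_chart R) v))
    (@lg_inv R (GG R) (gG a (b1 +i* b2)%C c e f)))).
  by rewrite cinvG G_conj cmapG.
apply: has_diff_row.
(* The derivative is first synthesised as an existential variable and then compared by [ring]. The
   identity has coordinates 0, whence the values of cos and sin at 0. *)
by do 6 (case => [_|]; [rewrite /=; eapply has_diff_eq; [has_diff_tac|
  rewrite ?(rV0E, mulr0) ?cos0 ?sin0; ring] |]).
Qed.

Lemma AdN a b1 b2 f xi : Ad (nN a (b1 +i* b2)%C f) xi = N_Ad a b1 b2 xi.
Proof.
rewrite /Ad /tmap.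
suff [_ ->] : has_diff (cmap (mchart (lg_chart (NN R))) \o
    (fun h : NN R => lg_mul (lg_mul (nN a (b1 +i* b2)%C f) h)
       (lg_inv (nN a (b1 +i* b2)%C f))) \o cinv (mchart (lg_chart (NN R))))
    (cmap (mchart (lg_chart (NN R))) (lg_one (NN R))) xi (N_Ad a b1 b2 xi) by [].
rewrite [cmap _ _]cmapN_one.
rewrite (_ : _ \o _ = fun v : 'rV[R]_4 => \row_(k < 4) nth 0 [:: v 0 (inord 0);
   b1 + (cos (2 * pi * a) * v 0 (inord 1) - sin (2 * pi * a) * v 0 (inord 2))
    - (cos (2 * pi * v 0 (inord 0)) * b1 - sin (2 * pi * v 0 (inord 0)) * b2);
   b2 + (cos (2 * pi * a) * v 0 (inord 2) + sin (2 * pi * a) * v 0 (inord 1))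
    - (cos (2 * pi * v 0 (inord 0)) * b2 + sin (2 * pi * v 0 (inord 0)) * b1);
   v 0 (inord 3)] k); last first.
  apply/funext => v.
  rewrite -[LHS]/(cmap (@N_chart R) (@lg_mul R (NN R)
    (@lg_mul R (NN R) (nN a (b1 +i* b2)%C f) (cinv (@N_chart R) v))
    (@lg_inv R (NN R) (nN a (b1 +i* b2)%C f)))).
  by rewrite cinvN N_conj cmapN.
apply: has_diff_row.
by do 4 (case => [_|]; [rewrite /=; eapply has_diff_eq; [has_diff_tac|
  rewrite ?(rV0E, mulr0) ?cos0 ?sin0; ring] |]).
Qed.

Lemma bracketG (xi eta : 'rV[R]_6) :
  let x k := xi 0 (inord k) in let y k := eta 0 (inord k) in
  @bracket R (GG R) xi eta = \row_(k < 6) nth 0 [:: 0;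
    2 * pi * (y 0%N * x 2%N - x 0%N * y 2%N); 2 * pi * (x 0%N * y 1%N - y 0%N * x 1%N);
    0; 0; x 3%N * y 4%N + x 4%N * y 0%N - x 4%N * y 3%N - x 0%N * y 4%N] k.
Proof.
move=> x y; rewrite /bracket; set d := \row_k _.
suff [_ ->] : has_diff (fun v => Ad (cinv (mchart (lg_chart (GG R))) v) eta)
  (cmap (mchart (lg_chart (GG R))) (lg_one (GG R))) xi d by [].
rewrite [cmap _ _]cmapG_one.
rewrite (_ : (fun v => _) = fun v : 'rV[R]_6 => G_Ad (v 0 (inord 0)) (v 0 (inord 1))
    (v 0 (inord 2)) (v 0 (inord 3)) (v 0 (inord 4)) eta); last first.
  by apply/funext => v; rewrite [cinv _ _]cinvG AdG.
rewrite /d /x /y {d x y}.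
apply: has_diff_row.
by do 6 (case => [_|]; [rewrite /=; eapply has_diff_eq; [has_diff_tac|
  rewrite ?(rV0E, mulr0) ?cos0 ?sin0; ring] |]).
Qed.

(** The formula is linear in [mu], and is therefore applied to tangent vectors of the orbit as well
    as to its points. *)
Definition G_coad (a b1 b2 c e : R) (mu : 'rV[R]_6) : 'rV[R]_6 :=
  let m k := mu 0 (inord k) in
  let m1 := cos (2 * pi * a) * m 1%N - sin (2 * pi * a) * m 2%N in
  let m2 := cos (2 * pi * a) * m 2%N + sin (2 * pi * a) * m 1%N in
  \row_(k < 6) nth 0 [:: m 0%N + 2 * pi * (b1 * m2 - b2 * m1) - e * m 5%N;
    m1; m2; m 3%N + e * m 5%N; m 4%N + (a - c) * m 5%N; m 5%N] k.

Definition N_coad (a b1 b2 : R) (mu : 'rV[R]_4) : 'rV[R]_4 :=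
  let m k := mu 0 (inord k) in
  let m1 := cos (2 * pi * a) * m 1%N - sin (2 * pi * a) * m 2%N in
  let m2 := cos (2 * pi * a) * m 2%N + sin (2 * pi * a) * m 1%N in
  \row_(k < 4) nth 0 [:: m 0%N + 2 * pi * (b1 * m2 - b2 * m1); m1; m2; m 3%N] k.

Lemma pairing_sum n (mu xi : 'rV[R]_n) : pairing mu xi = \sum_k mu 0 k * xi 0 k.
Proof. by rewrite /pairing mxE; apply: eq_bigr => k _; rewrite mxE. Qed.

Lemma inord_eq n (i : 'I_n.+1) k : (k <= n)%N -> (i == inord k) = (val i == k).
Proof. by move=> kn; rewrite -val_eqE /= inordK. Qed.

(** Coordinates are written with [inord k] for a numeral k; this brings sums over ordinals to a form
    that unrolls into such terms. *)
Lemma sum_inord n (F : 'I_n.+1 -> R) :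
  \sum_i F i = \sum_(0 <= i < n.+1) F (inord i).
Proof. by rewrite big_mkord; apply: eq_bigr => i _; rewrite inord_val. Qed.

Lemma coadG a b1 b2 c e f mu :
  @coad R (GG R) (gG a (b1 +i* b2)%C c e f) mu = G_coad a b1 b2 c e mu.
Proof.
rewrite /coad gG_inv expj_complex mulrN cosN sinN.
rewrite (_ : - _ = (- (cos (2 * pi * a) * b1 + sin (2 * pi * a) * b2) +i*
    - (cos (2 * pi * a) * b2 - sin (2 * pi * a) * b1))%C); last first.
  by apply/eqP; rewrite eq_complex /= !mulNr opprK !eqxx.
apply/rowP => k; rewrite [LHS]mxE AdG pairing_sum sum_inord.
rewrite !big_nat_recr //= big_geq // add0r !mxE !inordK //= mulrN cosN sinN.
rewrite ![_ == k]eq_sym !inord_eq //.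
by case: k => [[|[|[|[|[|[|k]]]]]] hk] //=; ring.
Qed.

Lemma coadN a b1 b2 f mu :
  @coad R (NN R) (nN a (b1 +i* b2)%C f) mu = N_coad a b1 b2 mu.
Proof.
rewrite /coad nN_inv expj_complex mulrN cosN sinN.
rewrite (_ : - _ = (- (cos (2 * pi * a) * b1 + sin (2 * pi * a) * b2) +i*
    - (cos (2 * pi * a) * b2 - sin (2 * pi * a) * b1))%C); last first.
  by apply/eqP; rewrite eq_complex /= !mulNr opprK !eqxx.
apply/rowP => k; rewrite [LHS]mxE AdN pairing_sum sum_inord.
rewrite !big_nat_recr //= big_geq // add0r !mxE !inordK //= mulrN cosN sinN.
rewrite ![_ == k]eq_sym !inord_eq //.
by case: k => [[|[|[|[|k]]]] hk] //=; ring.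
Qed.

Definition G_restr (mu : 'rV[R]_6) : 'rV[R]_4 :=
  \row_(k < 4) nth 0 [:: mu 0 (inord 0); mu 0 (inord 1); mu 0 (inord 2); mu 0 (inord 5)] k.

Definition N_lift (xi : 'rV[R]_4) : 'rV[R]_6 :=
  \row_(k < 6) nth 0 [:: xi 0 (inord 0); xi 0 (inord 1); xi 0 (inord 2); 0; 0;
    xi 0 (inord 3)] k.

Lemma N_inclL (v : 'rV[R]_4) :
  N_incl (cinv (@N_chart R) v) = cinv (@G_chart R) (N_lift v).
Proof. by rewrite cinvN cinvG N_inclE /N_lift !mxE !inordK. Qed.

Lemma tmap_N_incl (xi : 'rV[R]_4) :
  tmap (@N_incl R) (lg_chart (NN R)) (lg_chart (GG R)) (lg_one (NN R)) xi = N_lift xi.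
Proof.
rewrite /tmap.
suff [_ ->] : has_diff (cmap (mchart (lg_chart (GG R))) \o @N_incl R \o
    cinv (mchart (lg_chart (NN R)))) (cmap (mchart (lg_chart (NN R))) (lg_one (NN R)))
    xi (N_lift xi) by [].
rewrite (_ : _ \o _ = N_lift); last first.
  apply/funext => v.
  rewrite -[LHS]/(cmap (@G_chart R) (N_incl (cinv (@N_chart R) v))).
  by rewrite N_inclL G_cinvK.
apply: has_diff_row.
by do 6 (case => [_|]; [rewrite /=; has_diff_tac |]).
Qed.

Lemma lie_restrE (mu : 'rV[R]_6) : lie_restr (@N_incl R) mu = G_restr mu.
Proof.
apply/rowP => k; rewrite [LHS]mxE tmap_N_incl pairing_sum sum_inord.
rewrite !big_nat_recr //= big_geq // add0r !mxE !inordK //=.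
rewrite ![_ == k]eq_sym !inord_eq //.
by case: k => [[|[|[|[|k]]]] hk] //=; ring.
Qed.

(** In the parameters p, q, r, s the action is by translations, up to the angular term in p. For c =
    e = 0 it fixes r and moves q and s by the same amount a, which is the source of the
    monodromy. *)
Lemma G_coad_gdual a b1 b2 c e p q r s :
  G_coad a b1 b2 c e (gdual p (expj q) r s 1) =
  gdual (p + 2 * pi * (b1 * sin (2 * pi * (q + a)) - b2 * cos (2 * pi * (q + a))) + e)
    (expj (q + a)) (r + e) (s + a - c) (1 : R).
Proof.
rewrite /G_coad /gdual; apply/rowP => k; rewrite !mxE !inordK //= !(mulrDr (2 * pi) q a) !cosD !sinD.
by case: k => [[|[|[|[|[|[|k]]]]]] hk] //=; ring.
Qed.

Lemma orbXE : orbX R = [set nu | exists p q r s : R, nu = gdual p (expj q) r s 1].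
Proof.
have g0 : gdual 0 1 0 0 1 = gdual 0 (expj 0) 0 0 (1 : R) by rewrite expj0.
rewrite /orbX g0; apply/seteqP; split => [_ [g _ <-]|_ [p [q [r [s ->]]]]].
  have [a [[b1 b2] [c [e [f ->]]]]] := gG_case g.
  by rewrite coadG G_coad_gdual; do 4 eexists.
have pi0 : pi != 0 :> R by rewrite gt_eqF // pi_gt0.
(* By [G_coad_gdual] the angle forces a = q, then r forces e = r and s forces c = q - s. Since e
   also adds r to the first coordinate, b has to contribute p - r, and is taken along (sin, -
   cos). *)
exists (gG q ((p - r) * sin (2 * pi * q) / (2 * pi) +i*
   - ((p - r) * cos (2 * pi * q) / (2 * pi)))%C (q - s) r 0) => //.
rewrite coadG G_coad_gdual !add0r; congr gdual; last by ring.
rewrite (_ : 2 * pi * _ = (p - r) * (cos (2 * pi * q) ^+ 2 + sin (2 * pi * q) ^+ 2)).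
  by rewrite cos2Dsin2 mulr1 subrK.
by move: (@pi R) pi0 => P P0; field.
Qed.

Lemma coad_orbX (g : GG R) mu : orbX R mu -> orbX R (coad g mu).
Proof.
rewrite orbXE => -[p [q [r [s ->]]]].
have [a [[b1 b2] [c [e [f ->]]]]] := gG_case g.
by rewrite coadG G_coad_gdual; do 4 eexists.
Qed.

Lemma orbit_actE (g : GG R) (x : orbX R) :
  set_val (orbit_act g x) = coad g (set_val x).
Proof.
rewrite /orbit_act /insubd insubT //; apply/mem_set/coad_orbX.
exact: set_valP.
Qed.

End Coadjoint.

(** * Stereographic charts of X *)

Section OrbitManifold.
Variable R : realType.

Notation e6 m k := (m 0 (@inord 5 k)).

Lemma circle_angle (x y : R) : x * x + y * y = 1 ->
  exists q, cos (2 * pi * q) = x /\ sin (2 * pi * q) = y.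
Proof.
move=> xy.
have pi0 : 2 * pi != 0 :> R by rewrite mulf_neq0 // gt_eqF // pi_gt0.
have x1 : -1 <= x <= 1 by apply/andP; split; nra.
have yE : sin (acos x) = `|y|.
  by rewrite sin_acos // -sqrtr_sqr; congr Num.sqrt; rewrite !expr2; lra.
have [y0|y0] := leP 0 y.
  exists (acos x / (2 * pi)); rewrite mulrC divfK // acosK ?in_itv //= yE.
  by rewrite ger0_norm.
exists (- (acos x / (2 * pi))); rewrite mulrN mulrC divfK // cosN sinN.
by rewrite acosK ?in_itv //= yE ltr0_norm ?opprK.
Qed.

(** Implicit equations replace the multivalued angle q, so that charts, tangent spaces and the form
    can be handled algebraically. *)
Lemma orbX_memP (m : 'rV[R]_6) :
  orbX R m <-> e6 m 1 * e6 m 1 + e6 m 2 * e6 m 2 = 1 /\ e6 m 5 = -1.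
Proof.
rewrite orbXE; split => [[p [q [r [s ->]]]]|[xy m5]].
  rewrite /gdual !mxE !inordK //=; split => //.
  by rewrite -!expr2 cos2Dsin2.
have [q [qx qy]] := circle_angle xy.
exists (e6 m 0), q, (- e6 m 3), (- e6 m 4).
rewrite [LHS]rV_inord /gdual; apply/rowP => k; rewrite !mxE.
by case: k => [[|[|[|[|[|[|k]]]]]] hk] //=; rewrite ?opprK.
Qed.

Section Stereographic.
Variable s : R.
Hypothesis s2 : s * s = 1.

(** The sign [s] (not the orbit parameter) selects the centre (-s, 0) of a projection of the circle,
    and [h] is the slope of the line joining that centre to the point. The two signs give two
    rational charts that cover the orbit; the condition 1 + s x > 0 removes exactly the centre. *)
Definition stereo_pt (v : 'rV[R]_4) : 'rV[R]_6 :=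
  let h := v 0 (inord 1) in let d := (1 + h * h)^-1 in
  \row_(k < 6) nth 0 [:: v 0 (inord 0); s * ((1 - h * h) * d); s * (2 * h * d);
     v 0 (inord 2); v 0 (inord 3); -1] k.

Lemma stereo_den (h : R) : 1 + h * h != 0.
Proof. by rewrite gt_eqF //; nra. Qed.

Lemma stereo_denE (h : R) :
  1 + s * (s * ((1 - h * h) * (1 + h * h)^-1)) = 2 * (1 + h * h)^-1.
Proof. by have hd := stereo_den h; rewrite mulrA s2 mul1r; field. Qed.

Lemma stereo_pt_orbX v : orbX R (stereo_pt v).
Proof.
apply/orbX_memP; rewrite /stereo_pt !mxE !inordK //=; split => //.
set h := v 0 (inord 1); have hd := stereo_den h.
rewrite (_ : _ + _ = s * s * ((1 - h * h) ^+ 2 + (2 * h) ^+ 2) * (1 + h * h)^-1 ^+ 2); last by ring.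
by rewrite s2; field.
Qed.

Definition stereo_dom : set (orbX R) := [set x | 0 < 1 + s * e6 (set_val x : 'rV[R]_6) 1].

Definition stereo_fun (m : 'rV[R]_6) : 'rV[R]_4 :=
  \row_(k < 4) nth 0 [:: e6 m 0; s * e6 m 2 * (1 + s * e6 m 1)^-1; e6 m 3; e6 m 4] k.

Definition stereo_chart : chart R (orbX R) 4 :=
  Chart stereo_dom (fun x => stereo_fun (set_val x))
    (fun v => SigSub (mem_set (stereo_pt_orbX v))).

Lemma stereo_funK m : orbX R m -> 0 < 1 + s * e6 m 1 ->
  stereo_pt (stereo_fun m) = m.
Proof.
move=> /orbX_memP[xy m5] d0; rewrite /stereo_pt /stereo_fun !mxE !inordK //=.
have dn0 : 1 + s * e6 m 1 != 0 by rewrite gt_eqF.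
rewrite [RHS]rV_inord; set x := e6 m 1 in xy d0 dn0 *; set y := e6 m 2 in xy *.
(* The equation of the circle in factored form, which turns the square of the slope into (1 - s x) /
   (1 + s x). *)
have yy : y * y = (1 + s * x) * (1 - s * x).
  have -> : (1 + s * x) * (1 - s * x) = 1 - (s * s) * (x * x) by ring.
  by rewrite s2; lra.
set h := s * y / (1 + s * x).
have hh : h * h = (1 - s * x) / (1 + s * x).
  rewrite /h (_ : _ * _ = (s * s) * (y * y) / (1 + s * x) ^+ 2); last by field.
  by rewrite s2 yy; field.
have hd : (1 + h * h)^-1 = (1 + s * x) / 2.
  have -> : 1 + h * h = 2 / (1 + s * x) by rewrite hh; field.
  by rewrite invf_div.
apply/rowP => k; rewrite !mxE.
case: k => [[|[|[|[|[|[|k]]]]]] hk] //=.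
- rewrite hd hh -/x (_ : s * _ = s * s * x); last by field.
  by rewrite s2 mul1r.
- rewrite hd -/y /h (_ : s * _ = s * s * y); last by field.
  by rewrite s2 mul1r.
Qed.

Lemma stereo_ptK v : stereo_fun (stereo_pt v) = v.
Proof.
rewrite [RHS]rV_inord; apply/rowP => k; rewrite !mxE !inordK //=.
case: k => [[|[|[|[|k]]]] hk] //=.
set h := v 0 (inord 1); have hd := stereo_den h.
rewrite stereo_denE !(mulrA s s) s2 mul1r.
by field.
Qed.

Lemma stereo_pt_dom v : 0 < 1 + s * e6 (stereo_pt v) 1.
Proof.
rewrite /stereo_pt !mxE !inordK //=; set h := v 0 (inord 1).
by rewrite stereo_denE mulr_gt0 // invr_gt0; nra.
Qed.

Lemma stereo_cimg : cimg stereo_chart = setT.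
Proof.
apply/seteqP; split => // v _.
exists (cinv stereo_chart v); first exact: stereo_pt_dom.
exact: stereo_ptK.
Qed.

Lemma stereo_fun_open : open [set m : 'rV[R]_6 | 0 < 1 + s * e6 m 1].
Proof.
have c : continuous (fun m : 'rV[R]_6 => 1 + s * e6 m 1).
  move=> m; apply: (@smooth_continuous R _ _ setT) => //; smooth_tac.
have o : open [set x : R | 0 < x] by exact: open_gt.
by move/continuousP: c => /(_ _ o).
Qed.

Lemma stereo_fun_smooth : smooth_on [set m : 'rV[R]_6 | 0 < 1 + s * e6 m 1] stereo_fun.
Proof.
have oA := stereo_fun_open.
apply: smooth_row => //.
by do 4 (case => [_|]; [rewrite /=; smooth_tac;
  try (apply: smooth_inv => //; [by move=> m m0; rewrite gt_eqF|smooth_tac])|]).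
Qed.

Lemma stereo_pt_smooth : smooth_on setT stereo_pt.
Proof.
apply: smooth_row; first exact: openT.
by do 6 (case => [_|]; [rewrite /=; smooth_tac; try (apply: smooth_inv;
  [exact: openT|by move=> v _; exact: stereo_den|smooth_tac])|]).
Qed.

Lemma stereo_is_chart : is_chart stereo_chart.
Proof.
split.
- have := @set_val_continuous _ (orbX R).
  by move/continuousP => /(_ _ stereo_fun_open).
- by rewrite stereo_cimg; exact: openT.
- move=> x dx; apply: val_inj; apply: stereo_funK => //.
  exact: set_valP.
- move=> x dx; apply: continuous_comp; first exact: set_val_continuous.
  exact: smooth_continuous stereo_fun_smooth dx.
- move=> v _; apply: continuous_set_val.
  exact: smooth_continuous stereo_pt_smooth _.
Qed.

Lemma stereo_is_subchart : is_subchart stereo_chart.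
Proof.
split; first exact: stereo_is_chart.
- by rewrite stereo_cimg; exact: stereo_pt_smooth.
- move=> x dx; exists [set m : 'rV[R]_6 | 0 < 1 + s * e6 m 1], stereo_fun.
  by split => //; [exact: stereo_fun_open|exact: stereo_fun_smooth].
Qed.

End Stereographic.

Lemma orbX_manifold : is_manifold (sub_mfd 4 (orbX R)).
Proof.
apply: sub_mfd_is_manifold => x.
have p1 : 1 * 1 = 1 :> R by rewrite mulr1.
have n1 : -1 * -1 = 1 :> R by rewrite mulrNN mulr1.
have [x0|x0] := leP 0 (e6 (set_val x : 'rV[R]_6) 1).
  exists (stereo_chart p1); first exact: stereo_is_subchart.
  by rewrite /= /stereo_dom /= mul1r; apply: ltr_wpDr.
exists (stereo_chart n1); first exact: stereo_is_subchart.
by rewrite /= /stereo_dom /= mulN1r addr_gt0 // oppr_gt0.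
Qed.

End OrbitManifold.

(** * The ambient form of X *)

Section OrbitForm.
Variable R : realType.

Notation e6 m k := (m 0 (@inord 5 k)).
Notation e4 m k := (m 0 (@inord 3 k)).

Lemma two_pi_neq0 : 2 * pi != 0 :> R.
Proof. by rewrite mulf_neq0 // gt_eqF // pi_gt0. Qed.

(** The value at [m] of the fundamental vector field of [xi]: the derivative of [G_coad] at the
    identity. *)
Definition ad_star (m xi : 'rV[R]_6) : 'rV[R]_6 :=
  \row_(k < 6) nth 0 [:: 2 * pi * (e6 xi 1 * e6 m 2 - e6 xi 2 * e6 m 1) - e6 xi 4 * e6 m 5;
    - (2 * pi * e6 xi 0 * e6 m 2); 2 * pi * e6 xi 0 * e6 m 1; e6 xi 4 * e6 m 5;
    (e6 xi 0 - e6 xi 3) * e6 m 5; 0] k.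

(** The equations of [orbX_memP], linearised at [m]. *)
Definition orb_tangent (m u : 'rV[R]_6) : Prop :=
  e6 m 1 * e6 u 1 + e6 m 2 * e6 u 2 = 0 /\ e6 u 5 = 0.

(* The form dp /\ dq + dr /\ ds - dr /\ dq, where dq is the restriction of
   (x dy - y dx) / 2 pi and the last coordinates of [m] are -r, -s. *)
Definition orb_form (m u v : 'rV[R]_6) : R :=
  ((e6 u 0 + e6 u 3) * (e6 m 1 * e6 v 2 - e6 m 2 * e6 v 1)
   - (e6 v 0 + e6 v 3) * (e6 m 1 * e6 u 2 - e6 m 2 * e6 u 1)) / (2 * pi)
  + (e6 u 3 * e6 v 4 - e6 u 4 * e6 v 3).

Lemma pairing6 (mu xi : 'rV[R]_6) : pairing mu xi =
  e6 mu 0 * e6 xi 0 + e6 mu 1 * e6 xi 1 + e6 mu 2 * e6 xi 2 + e6 mu 3 * e6 xi 3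
  + e6 mu 4 * e6 xi 4 + e6 mu 5 * e6 xi 5.
Proof. by rewrite pairing_sum sum_inord !big_nat_recr //= big_geq // add0r. Qed.

Lemma pairing_ad_star (m xi eta : 'rV[R]_6) :
  pairing (ad_star m eta) xi = - pairing m (@bracket R (GG R) eta xi).
Proof.
rewrite bracketG !pairing6 /ad_star !mxE !inordK //=; ring.
Qed.

(** A vector orthogonal to the unit vector (x, y) is a multiple of (-y, x). The multiplier is 2 pi
    dq(u), so the circle directions of [u] are carried by one number. *)
Lemma tangent_rotation (m u : 'rV[R]_6) : orbX R m -> orb_tangent m u ->
  let k := e6 m 1 * e6 u 2 - e6 m 2 * e6 u 1 in
  e6 u 1 = - (e6 m 2 * k) /\ e6 u 2 = e6 m 1 * k.
Proof.
move=> /orbX_memP[xy _] [t _] k.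
split.
  transitivity ((e6 m 1 * e6 m 1 + e6 m 2 * e6 m 2) * e6 u 1
    - e6 m 1 * (e6 m 1 * e6 u 1 + e6 m 2 * e6 u 2)); first by rewrite xy t; ring.
  by rewrite /k; ring.
transitivity ((e6 m 1 * e6 m 1 + e6 m 2 * e6 m 2) * e6 u 2
  - e6 m 2 * (e6 m 1 * e6 u 1 + e6 m 2 * e6 u 2)); first by rewrite xy t; ring.
by rewrite /k; ring.
Qed.

(** The moment map identity for the inclusion of the orbit, in ambient terms. The KKS identity,
    nondegeneracy and the moment map of [N] are all drawn from it. *)
Lemma orb_form_ad_star (m xi w : 'rV[R]_6) : orbX R m -> orb_tangent m w ->
  orb_form m (ad_star m xi) w = - pairing w xi.
Proof.
move=> Xm tw; have [w1 w2] := tangent_rotation Xm tw.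
have /orbX_memP[xy m5] := Xm; have [_ w5] := tw.
rewrite /orb_form pairing6 /ad_star !mxE !inordK //= m5 w5.
set k := _ - _ in w1 w2 *; rewrite w1 w2.
have -> : e6 m 1 * (2 * pi * e6 xi 0 * e6 m 1) - e6 m 2 * - (2 * pi * e6 xi 0 * e6 m 2)
   = 2 * pi * e6 xi 0 * (e6 m 1 * e6 m 1 + e6 m 2 * e6 m 2) by ring.
rewrite xy; have := two_pi_neq0; move: (2 * pi) => T T0; field.
exact: T0.
Qed.

Lemma ad_star_tangent (m xi : 'rV[R]_6) : orb_tangent m (ad_star m xi).
Proof. by rewrite /orb_tangent /ad_star !mxE !inordK //=; split => //; ring. Qed.

Lemma tangent_ad_star (m u : 'rV[R]_6) : orbX R m -> orb_tangent m u ->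
  exists xi, ad_star m xi = u.
Proof.
move=> Xm tu; have [u1 u2] := tangent_rotation Xm tu.
have /orbX_memP[xy m5] := Xm; have [_ u5] := tu.
set k := _ - _ in u1 u2.
have T0 := two_pi_neq0.
(* Solving [ad_star m xi = u] with [e6 m 5 = -1]: the circle directions give the a-entry, the
   coordinates 3 and 4 then give the e- and c-entries. The b-entries need only one linear equation
   and are taken along (y, -x), of norm 1; the central f-entry acts trivially and is set to 0. *)
exists (\row_(j < 6) nth 0 [:: k / (2 * pi);
   (e6 u 0 + e6 u 3) * e6 m 2 / (2 * pi); - ((e6 u 0 + e6 u 3) * e6 m 1 / (2 * pi));
   e6 u 4 + k / (2 * pi); - e6 u 3; 0] j).
rewrite [RHS]rV_inord; apply/rowP => j; rewrite /ad_star !mxE !inordK //= m5.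
case: j => [[|[|[|[|[|[|j]]]]]] hj] //=.
- rewrite (_ : _ - _ = (e6 u 0 + e6 u 3) * (e6 m 1 * e6 m 1 + e6 m 2 * e6 m 2) - e6 u 3).
    by rewrite xy; ring.
  by move: (2 * pi) T0 => T T0; field.
- by rewrite u1; move: (2 * pi) T0 => T T0; field.
- by rewrite u2; move: (2 * pi) T0 => T T0; field.
- ring.
- ring.
Qed.

(** Write [u] as [ad_star m xi]. Orthogonality to all fundamental vectors says that [xi] pairs to 0
    with every [ad_star m eta]; antisymmetry of the bracket turns this into [pairing u eta = 0] for
    every eta. *)
Lemma orb_form_nondeg (m u : 'rV[R]_6) : orbX R m -> orb_tangent m u ->
  (forall v, orb_tangent m v -> orb_form m u v = 0) -> u = 0.
Proof.
move=> Xm tu H; have [xi xiE] := tangent_ad_star Xm tu.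
have P v : orb_tangent m v -> pairing v xi = 0.
  by move=> tv; apply/eqP; rewrite -oppr_eq0 -(orb_form_ad_star xi Xm tv) xiE H.
have {}P eta : pairing (ad_star m eta) xi = 0 by apply/P/ad_star_tangent.
have Q eta : pairing u eta = 0.
  rewrite -xiE.
  transitivity (- pairing (ad_star m eta) xi); last by rewrite P oppr0.
  rewrite !pairing_ad_star !bracketG !pairing6 !mxE !inordK //=; ring.
apply/rowP => k; rewrite rV0E -(Q (delta_mx 0 k)) pairing_sum (bigD1 k) //=.
rewrite mxE !eqxx mulr1 big1 ?addr0 // => i ik.
by rewrite mxE (negbTE ik) andbF mulr0.
Qed.

(** The rotation by a preserves the multipliers [ku] and [kv]. The b-part adds to the first
    coordinates of [u] and [v] the same factor times [ku] and [kv], which cancels by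
    antisymmetry. *)
Lemma orb_form_coad (a b1 b2 : R) (m u v : 'rV[R]_6) :
  orbX R m -> orb_tangent m u -> orb_tangent m v ->
  orb_form (G_coad a b1 b2 0 0 m) (G_coad a b1 b2 0 0 u) (G_coad a b1 b2 0 0 v)
  = orb_form m u v.
Proof.
move=> Xm tu tv; have [u1 u2] := tangent_rotation Xm tu.
have [v1 v2] := tangent_rotation Xm tv.
have [_ u5] := tu; have [_ v5] := tv.
rewrite /orb_form; set ku := e6 m 1 * e6 u 2 - _ in u1 u2 *.
set kv := e6 m 1 * e6 v 2 - _ in v1 v2 *.
rewrite /G_coad !mxE !inordK //= u5 v5 u1 u2 v1 v2.
set C := cos _; set S := sin _.
have CS : C ^+ 2 + S ^+ 2 = 1 by exact: cos2Dsin2.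
have /orbX_memP[xy _] := Xm.
set x := e6 m 1 in xy *; set y := e6 m 2 in xy *.
have rot k : (C * x - S * y) * (C * (x * k) + S * - (y * k)) -
   (C * y + S * x) * (C * - (y * k) - S * (x * k)) = k.
  transitivity ((C ^+ 2 + S ^+ 2) * (x * x + y * y) * k); first by ring.
  by rewrite CS xy !mul1r.
rewrite !rot; ring.
Qed.

Lemma orb_form_bilin (m : 'rV[R]_6) n (L : {linear 'rV[R]_n -> 'rV[R]_6}) (u v : 'rV[R]_n) :
  (u *m (\matrix_(a, b) orb_form m (L (delta_mx 0 a)) (L (delta_mx 0 b))) *m v^T) 0 0
  = orb_form m (L u) (L v).
Proof.
have linl w k z z' : orb_form m (k *: z + z') w = k * orb_form m z w + orb_form m z' w.
  rewrite /orb_form !mxE; ring.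
have linr w k z z' : orb_form m w (k *: z + z') = k * orb_form m w z + orb_form m w z'.
  rewrite /orb_form !mxE; ring.
have l0 w : orb_form m 0 w = 0 by rewrite /orb_form !mxE; ring.
have r0 w : orb_form m w 0 = 0 by rewrite /orb_form !mxE; ring.
have suml w (f : 'I_n -> 'rV[R]_6) (c : 'I_n -> R) :
    orb_form m (\sum_a c a *: f a) w = \sum_a c a * orb_form m (f a) w.
  by elim/big_rec2: _ => [|a y z _ <-]; rewrite ?l0 ?linl.
have sumr w (f : 'I_n -> 'rV[R]_6) (c : 'I_n -> R) :
    orb_form m w (\sum_a c a *: f a) = \sum_a c a * orb_form m w (f a).
  by elim/big_rec2: _ => [|a y z _ <-]; rewrite ?r0 ?linr.
have LE z : L z = \sum_a z 0 a *: L (delta_mx 0 a).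
  rewrite {1}(row_sum_delta z) linear_sum /=.
  by apply: eq_bigr => a _; rewrite linearZ.
rewrite [in RHS](LE u) [in RHS](LE v) suml -mulmxA mxE; apply: eq_bigr => a _.
rewrite mxE sumr; congr (_ * _); apply: eq_bigr => b _.
by rewrite !mxE mulrC.
Qed.

End OrbitForm.

(** * The KKS form in a chart *)

Section OrbitSymplectic.
Variable R : realType.

Notation e6 m k := (m 0 (@inord 5 k)).
Notation X := (sub_mfd 4 (orbX R)).

Definition orb_incl (c : chart R (orbX R) 4) (y : 'rV[R]_4) : 'rV[R]_6 :=
  set_val (cinv c y).

Lemma incl_orbX c y : orbX R (orb_incl c y).
Proof. exact: set_valP. Qed.

Lemma has_diff_continuous (V W : normedModType R) (f : V -> W) (x v : V) d :
  has_diff f x v d -> {for x, continuous f}.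
Proof. by move=> [df _]; exact: differentiable_continuous. Qed.

Section OneChart.
Variable c : chart R (orbX R) 4.
Hypothesis hc : is_subchart c.
Let i : mindex X := exist _ c hc.
Let chartc : is_chart c. Proof. by have [] := hc. Qed.

Lemma incl_has_diff (x : X) (u : 'rV[R]_4) : cdom c x ->
  has_diff (orb_incl c) (cmap c x) u ('d (orb_incl c) (cmap c x) u).
Proof. by move=> cx; apply: has_diffP; exact: incl_differentiable. Qed.

Lemma incl_cmap (x : X) : cdom c x -> orb_incl c (cmap c x) = set_val x.
Proof. by move=> cx; have [_ _ cK _ _] := chartc; rewrite /orb_incl cK. Qed.

Lemma incl_smooth_on : smooth_on (cimg c) (orb_incl c).
Proof. exact: incl_smooth. Qed.

Lemma incl_tangent (x : X) (u : 'rV[R]_4) : cdom c x ->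
  orb_tangent (set_val x) ('d (orb_incl c) (cmap c x) u).
Proof.
move=> cx; have H := incl_has_diff u cx.
have H1 := has_diff_entry 0 (inord 1) H.
have H2 := has_diff_entry 0 (inord 2) H.
have H5 := has_diff_entry 0 (inord 5) H.
split.
  have := has_diffD (has_diffM H1 H1) (has_diffM H2 H2).
  rewrite (_ : (fun y => _) = fun _ => 1); last first.
    by apply/funext => y; have /orbX_memP[-> _] := incl_orbX c y.
  move=> /has_diff_uniq /(_ (has_diff_cst _ _ _)).
  rewrite incl_cmap //; set a := (_ * _); set b := (_ * _); lra.
rewrite (_ : (fun y => _) = fun _ => -1) in H5; last first.
  by apply/funext => y; have /orbX_memP[_ ->] := incl_orbX c y.
exact: has_diff_uniq H5 (has_diff_cst _ _ _).
Qed.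

Lemma coad1 (m : 'rV[R]_6) : G_coad 0 0 0 0 0 m = m.
Proof.
rewrite [RHS]rV_inord; apply/rowP => k; rewrite /G_coad !mxE mulr0 cos0 sin0.
by case: k => [[|[|[|[|[|[|k]]]]]] hk] //=; ring.
Qed.

Lemma orbit_act1 (x : orbX R) : orbit_act (lg_one (GG R)) x = x.
Proof. by apply: val_inj; rewrite [LHS]orbit_actE gG_one coadG coad1. Qed.

(** The velocity is computed from [G_coad] in the ambient space and carried to the unknown chart by
    [subchart_tangent]. *)
Lemma incl_fund_vecG (x : X) (xi : 'rV[R]_6) : cdom c x ->
  'd (orb_incl c) (cmap c x) (@fund_vec R (GG R) X (@orbit_act R (GG R) (orbX R)) i x xi)
  = ad_star (set_val x) xi.
Proof.
move=> cx; pose phi (y : 'rV[R]_6) : orbX R :=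
  @orbit_act R (GG R) (orbX R) (cinv (@G_chart R) y) x.
have phiE : (fun y => set_val (phi y) : 'rV[R]_6) = fun y => G_coad (e6 y 0) (e6 y 1)
    (e6 y 2) (e6 y 3) (e6 y 4) (set_val x).
  by apply/funext => y; rewrite [LHS]orbit_actE cinvG coadG.
have phi0 : phi 0 = x.
  by rewrite -[RHS]orbit_act1 /phi -cmapG_one G_chartK.
have H : has_diff (fun y => set_val (phi y) : 'rV[R]_6) 0 xi (ad_star (set_val x) xi).
  rewrite phiE; apply: has_diff_row.
  by do 6 (case => [_|]; [rewrite /=; eapply has_diff_eq; [has_diff_tac|
    rewrite ?(rV0E, mulr0) ?cos0 ?sin0; ring] |]).
have cphi : {for 0, continuous phi}.
  by apply: continuous_set_val; exact: has_diff_continuous H.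
have dphi : cdom c (phi 0) by rewrite phi0.
have [u [_ Hu] [_ Hw]] := subchart_tangent hc cphi dphi H.
rewrite /fund_vec /tmap [cmap _ (lg_one _)]cmapG_one.
by rewrite phi0 in Hw; rewrite -Hw -Hu.
Qed.

Lemma incl_fund_vecN (x : X) (xi : 'rV[R]_4) : cdom c x ->
  'd (orb_incl c) (cmap c x)
    (@fund_vec R (NN R) X (fun h x => orbit_act (N_incl h) x) i x xi)
  = ad_star (set_val x) (N_lift xi).
Proof.
move=> cx; pose phi (y : 'rV[R]_4) : orbX R :=
  @orbit_act R (GG R) (orbX R) (N_incl (cinv (@N_chart R) y)) x.
have phiE : (fun y => set_val (phi y) : 'rV[R]_6) = fun y => G_coad (y 0 (inord 0))
    (y 0 (inord 1)) (y 0 (inord 2)) 0 0 (set_val x).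
  by apply/funext => y; rewrite [LHS]orbit_actE cinvN N_inclE coadG.
have phi0 : phi 0 = x.
  have E0 : cinv (@N_chart R) 0 = lg_one (NN R) by rewrite -cmapN_one N_chartK.
  have E1 : N_incl (lg_one (NN R)) = lg_one (GG R) by exact: val_inj.
  by rewrite /phi E0 E1 orbit_act1.
have H : has_diff (fun y => set_val (phi y) : 'rV[R]_6) 0 xi
    (ad_star (set_val x) (N_lift xi)).
  rewrite phiE; apply: has_diff_row.
  by do 6 (case => [_|]; [rewrite /=; eapply has_diff_eq; [has_diff_tac|
    rewrite /N_lift ?mxE ?inordK //= ?(rV0E, mulr0) ?cos0 ?sin0; ring] |]).
have cphi : {for 0, continuous phi}.
  by apply: continuous_set_val; exact: has_diff_continuous H.
have dphi : cdom c (phi 0) by rewrite phi0.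
have [u [_ Hu] [_ Hw]] := subchart_tangent hc cphi dphi H.
rewrite /fund_vec /tmap [cmap _ (lg_one _)]cmapN_one.
by rewrite phi0 in Hw; rewrite -Hw -Hu.
Qed.

Lemma fund_vecG_surj (x : X) (u : 'rV[R]_4) : cdom c x -> exists xi,
  u = @fund_vec R (GG R) X (@orbit_act R (GG R) (orbX R)) i x xi.
Proof.
move=> cx; have [xi xiE] := tangent_ad_star (set_valP (x : orbX R)) (incl_tangent u cx).
exists xi; apply: (subchart_immersion hc cx).
by rewrite -[LHS]xiE -(incl_fund_vecG _ cx).
Qed.

Lemma KKS_formE (w : form2 X) (x : X) (u v : 'rV[R]_4) : is_KKS w -> cdom c x ->
  form_eval w i x u v =
  orb_form (set_val x) ('d (orb_incl c) (cmap c x) u) ('d (orb_incl c) (cmap c x) v).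
Proof.
move=> [_ wK] cx; have [xi ->] := fund_vecG_surj u cx.
have [eta ->] := fund_vecG_surj v cx.
rewrite wK // !incl_fund_vecG // orb_form_ad_star; last exact: ad_star_tangent.
  by rewrite pairing_ad_star opprK.
exact: set_valP (x : orbX R).
Qed.

End OneChart.

(** An ambient derivative determines the tangent map in every chart of the target. It serves for
    changes of chart, with [f] the identity, and for the action of [N]. *)
Lemma tmap_incl (M : charted R) (f : M -> X) (a : mindex M) (b : mindex X) (x : M) u w :
  is_chart (mchart a) -> cdom (mchart a) x -> cdom (mchart b) (f x) ->
  {for x, continuous f} ->
  has_diff (fun y => set_val (f (cinv (mchart a) y)) : 'rV[R]_6) (cmap (mchart a) x) u w ->
  'd (orb_incl (mchart b)) (cmap (mchart b) (f x)) (tmap f a b x u) = w.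
Proof.
case: b => b hb ha ax bfx cf H.
have [_ _ aK _ ai] := ha.
have cphi : {for cmap (mchart a) x, continuous (f \o cinv (mchart a))}.
  apply: continuous_comp; first by apply: ai; exists x.
  by rewrite aK.
have bphi : cdom b ((f \o cinv (mchart a)) (cmap (mchart a) x)) by rewrite /= aK.
have [u' [_ Hu] [_ Hw]] := subchart_tangent hb cphi bphi H.
by rewrite /= aK // in Hw; rewrite -Hw -Hu.
Qed.

Definition orb_form2 : form2 X := fun i x =>
  \matrix_(a, b) orb_form (set_val x)
    ('d (orb_incl (mchart i)) (cmap (mchart i) x) (delta_mx 0 a))
    ('d (orb_incl (mchart i)) (cmap (mchart i) x) (delta_mx 0 b)).

Lemma orb_form2E i x u v : form_eval orb_form2 i x u v =
  orb_form (set_val x) ('d (orb_incl (mchart i)) (cmap (mchart i) x) u)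
    ('d (orb_incl (mchart i)) (cmap (mchart i) x) v).
Proof. exact: orb_form_bilin. Qed.

Lemma smooth_diff (V W : normedModType R) (A : set V) (f : V -> W) v :
  smooth_on A f -> smooth_on A (fun x => 'd f x v).
Proof. by move=> Cf k; have [_] := Cf k.+1; exact. Qed.

Lemma orb_form2_is_form2 : is_form2 orb_form2.
Proof.
split.
- move=> i x _; apply/matrixP => a b; rewrite !mxE /orb_form; ring.
- move=> i j x ci cj u v; rewrite !orb_form2E.
  case: i ci => c hc ci; have [chc _ _] := hc.
  have E z : 'd (orb_incl (mchart j)) (cmap (mchart j) x) (tmap (id : X -> X) (exist _ c hc) j x z)
      = 'd (orb_incl c) (cmap c x) z.
    apply: (@tmap_incl X id (exist _ c hc) j x) => //.
    exact: incl_has_diff.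
  exact: (f_equal2 (orb_form (set_val (x : orbX R))) (E u) (E v)).
- move=> [c hc]; have [chc _ _] := hc; have [_ oi _ _ _] := chc.
  apply: smooth_mx => // a b.
  apply: (@eq_smooth _ _ _ _ (fun y => orb_form (orb_incl c y)
     ('d (orb_incl c) y (delta_mx 0 a)) ('d (orb_incl c) y (delta_mx 0 b)))) => //.
    move=> y iy; rewrite !mxE /=.
    by have [_ ->] := chart_cinv chc iy.
  have si k : smooth_on (cimg c) (fun y => orb_incl c y 0 k).
    by apply: smooth_entry => //; exact: incl_smooth_on.
  have sd u k : smooth_on (cimg c) (fun y => 'd (orb_incl c) y u 0 k).
    by apply: smooth_entry => //; apply: smooth_diff; exact: incl_smooth_on.
  rewrite /orb_form.
  by do ?[exact: si|exact: sd|exact: smooth_cst|apply: smooth_add => //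
    |apply: smooth_opp => //|apply: smooth_mul => //].
Qed.

Lemma orb_form2_KKS : is_KKS orb_form2.
Proof.
split; first exact: orb_form2_is_form2.
move=> [c hc] x cx xi eta; rewrite orb_form2E.
rewrite !incl_fund_vecG // orb_form_ad_star; last exact: ad_star_tangent.
  by rewrite pairing_ad_star opprK.
exact: set_valP (x : orbX R).
Qed.

End OrbitSymplectic.

(** * Closedness and nondegeneracy *)

Section OrbitHamiltonian.
Variable R : realType.

Notation e6 m k := (m 0 (@inord 5 k)).
Notation X := (sub_mfd 4 (orbX R)).

Lemma has_diff_sum (V W : normedModType R) (I : Type) (r : seq I)
    (f : I -> V -> W) (d : I -> W) (x v : V) :
  (forall i, has_diff (f i) x v (d i)) ->
  has_diff (fun y => \sum_(i <- r) f i y) x v (\sum_(i <- r) d i).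
Proof.
move=> H; elim: r => [|i r IH].
  rewrite big_nil (_ : (fun y => _) = fun _ => 0); first exact: has_diff_cst.
  by apply/funext => y; rewrite big_nil.
rewrite big_cons (_ : (fun y => _) = fun y => f i y + \sum_(i <- r) f i y).
  exact: has_diffD.
by apply/funext => y; rewrite big_cons.
Qed.

Lemma has_diff_sandwich (V : normedModType R) m n (M : V -> 'M[R]_(m, n))
    (v : 'rV[R]_m) (s : 'rV[R]_n) (x u : V) (d : 'M[R]_(m, n)) :
  has_diff M x u d ->
  has_diff (fun y => (v *m M y *m s^T) 0 0) x u ((v *m d *m s^T) 0 0).
Proof.
move=> HM.
rewrite (_ : (fun y => _) = fun y => \sum_b (\sum_a v 0 a * M y a b) * s^T b 0).
  rewrite mxE; apply: has_diff_sum => b; rewrite [(v *m d) 0 b]mxE.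
  apply: has_diff_eq.
    apply: has_diffM; last exact: has_diff_cst.
    apply: has_diff_sum => a; apply: has_diff_eq.
      by apply: has_diffM; [exact: has_diff_cst|exact: (has_diff_entry a b HM)].
    by rewrite mulr0 addr0.
  by rewrite mulr0 add0r mulrC.
apply/funext => y; rewrite mxE; apply: eq_bigr => b _.
by rewrite [(v *m M y) 0 b]mxE.
Qed.

(* The derivative, in the direction u, of [orb_form] evaluated on the images
   of two constant fields v and s; [av], [hvu] are first and second
   derivatives of the ambient coordinates. *)
Definition orb_dform (T m1 m2 : R) (au av as_ hvu hsu : nat -> R) : R :=
  (((hvu 0 + hvu 3) * (m1 * as_ 2 - m2 * as_ 1)
   + (av 0 + av 3) * (au 1 * as_ 2 + m1 * hsu 2 - (au 2 * as_ 1 + m2 * hsu 1)))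
  - ((hsu 0 + hsu 3) * (m1 * av 2 - m2 * av 1)
   + (as_ 0 + as_ 3) * (au 1 * av 2 + m1 * hvu 2 - (au 2 * av 1 + m2 * hvu 1)))) * T
  + (hvu 3 * as_ 4 + av 3 * hsu 4 - (hvu 4 * as_ 3 + av 4 * hsu 3)).

(** Each second derivative occurs twice with opposite signs, once the two orders of differentiation
    are identified. The remaining terms contain dx /\ dy, which vanishes on the circle because its
    tangent vectors are all multiples of (-y, x); this is the closedness of dq. *)
Lemma orb_dform_cyclic (T m1 m2 ku kv ks : R) (au av as_ huv hvs hsu : nat -> R) :
  au 1%N = - (m2 * ku) -> au 2%N = m1 * ku ->
  av 1%N = - (m2 * kv) -> av 2%N = m1 * kv ->
  as_ 1%N = - (m2 * ks) -> as_ 2%N = m1 * ks ->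
  orb_dform T m1 m2 au av as_ huv hsu + orb_dform T m1 m2 av as_ au hvs huv
  + orb_dform T m1 m2 as_ au av hsu hvs = 0.
Proof.
rewrite /orb_dform => -> -> -> -> -> ->; ring.
Qed.

Lemma KKS_closed (w : form2 X) : is_KKS w -> is_closed_form w.
Proof.
move=> wK; have [[_ _ wsm] _] := wK.
move=> i; have := wsm i; case: i => c hc Wsm y iy dw u v s.
have {}Wsm : smooth_on (cimg c) (w (exist _ c hc) \o cinv c) := Wsm.
have {}iy : cimg c y := iy.
have [chc _ _] := hc; have [_ oi _ _ _] := chc.
pose W : 'rV[R]_4 -> 'M[R]_4 := w (exist _ c hc) \o cinv c.
have dW : differentiable W y := smooth_on_differentiable Wsm iy.
have [cy yE] := chart_cinv chc iy.
pose D z p k := 'd (orb_incl c) z p 0 (@inord 5 k) : R.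
pose H p q k := 'd (fun z => 'd (orb_incl c) z p) y q 0 (@inord 5 k) : R.
have inclsm := incl_smooth_on hc.
have Hincl z p : cimg c z -> has_diff (orb_incl c) z p ('d (orb_incl c) z p).
  by move=> iz; apply/has_diffP/(smooth_on_differentiable inclsm).
have HD p q k : has_diff (fun z => D z p k) y q (H p q k).
  apply: has_diff_entry; apply: has_diffP.
  exact: smooth_on_differentiable (smooth_diff p inclsm) iy.
have ni : \forall z \near y, cimg c z by exact: open_nbhs_nbhs.
(* Schwarz' theorem for each ambient coordinate of the inclusion. *)
have HC p q k : H p q k = H q p k.
  pose f z := orb_incl c z 0 (@inord 5 k) : R.
  have fsm : smooth_on (cimg c) f by apply: smooth_entry.
  have fD z p' : cimg c z -> 'd f z p' = D z p' k.
    by move=> iz; exact: (has_diff_entry 0 (@inord 5 k) (Hincl z p' iz)).2.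
  have Hf p' q' : 'd (fun z => 'd f z p') y q' = H p' q' k.
    have H1 : has_diff (fun z => 'd f z p') y q' (H p' q' k).
      by apply: has_diff_near (HD p' q' k); apply: filterS ni => z iz; rewrite fD.
    by have [] := H1.
  by rewrite -!Hf; exact: diff_diffC oi iy (fsm 2%N).
pose m1 := orb_incl c y 0 (@inord 5 1) : R; pose m2 := orb_incl c y 0 (@inord 5 2) : R.
have main p q r : (p *m dw r *m q^T) 0 0 =
    orb_dform (2 * pi)^-1 m1 m2 (D y r) (D y p) (D y q) (H p r) (H q r).
  have H1 := has_diff_sandwich p q (has_diffP r dW).
  (* [KKS_formE] holds at every point of the chart, so the matrix entry and the ambient expression
     agree near [y] and have the same derivative. *)
  have H2 : has_diff (fun z => orb_form (orb_incl c z) ('d (orb_incl c) z p) ('d (orb_incl c) z q))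
      y r ((p *m dw r *m q^T) 0 0).
    apply: has_diff_near H1; apply: filterS ni => z iz.
    have [cz zE] := chart_cinv chc iz.
    have := @KKS_formE R c hc w (cinv c z) p q wK cz.
    by rewrite zE.
  pose F k z := orb_incl c z 0 (@inord 5 k) : R.
  have HF k : has_diff (F k) y r (D y r k).
    exact: has_diff_entry (Hincl y r iy).
  have {}H2 : has_diff (fun z =>
     ((D z p 0%N + D z p 3%N) * (F 1%N z * D z q 2%N - F 2%N z * D z q 1%N)
      - (D z q 0%N + D z q 3%N) * (F 1%N z * D z p 2%N - F 2%N z * D z p 1%N)) / (2 * pi)
     + (D z p 3%N * D z q 4%N - D z p 4%N * D z q 3%N)) y r ((p *m dw r *m q^T) 0 0) := H2.
  rewrite -/(F 1%N y) -/(F 2%N y) in m1 m2 *.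
  apply: (has_diff_uniq H2); rewrite /orb_dform /m1 /m2.
  move: (2 * pi)^-1 => T.
  clear - HF HD; clearbody F D H.
  eapply has_diff_eq.
    repeat first [exact: HF|exact: HD|exact: has_diff_cst|apply: has_diffD
      |apply: has_diffN|apply: has_diffM].
  rewrite /=; ring.
have rot p : exists k, D y p 1%N = - (m2 * k) /\ D y p 2%N = m1 * k.
  have := incl_tangent hc p cy; rewrite yE => tp.
  have := tangent_rotation (set_valP (cinv c y)) tp.
  by set k := _ - _ => H12; exists k.
have [ku [u1 u2]] := rot u; have [kv [v1 v2]] := rot v.
have [ks [s1 s2]] := rot s.
rewrite mxE [X in X + _]mxE !main.
(* One order is chosen for each of the three pairs, so that the terms to be cancelled become
   syntactically equal. *)
rewrite (funext (HC v u)) (funext (HC s v)) (funext (HC u s)).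
exact: orb_dform_cyclic u1 u2 v1 v2 s1 s2.
Qed.

Lemma KKS_symplectic (w : form2 X) : is_KKS w -> Defs.is_symplectic w.
Proof.
move=> wK; split; [by case: wK|exact: KKS_closed|].
move=> [c hc] x cx u wu.
apply: (subchart_immersion hc cx); rewrite -/(orb_incl c) linear0.
apply: (orb_form_nondeg (set_valP (x : orbX R))); first exact: incl_tangent.
move=> z tz; have [xi xiE] := tangent_ad_star (set_valP (x : orbX R)) tz.
rewrite -xiE -(incl_fund_vecG hc _ cx) -(KKS_formE hc _ _ wK cx).
exact: wu.
Qed.

End OrbitHamiltonian.

(** * X as a hamiltonian N-space *)

Section Hamiltonian.
Variable R : realType.

Notation e6 m k := (m 0 (@inord 5 k)).
Notation X := (sub_mfd 4 (orbX R)).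

Lemma chart_continuous (M : charted R) (T : topologicalType) (f : M -> T) :
  (forall i, is_chart (@mchart R M i)) ->
  (forall x : M, exists i, cdom (@mchart R M i) x) ->
  (forall i y, cimg (@mchart R M i) y -> {for y, continuous (f \o cinv (mchart i))}) ->
  continuous f.
Proof.
move=> Mch Mcov cf x; have [i ix] := Mcov x.
have [oi _ iK cc _] := Mch i.
have c1 : {for x, continuous ((f \o cinv (mchart i)) \o cmap (mchart i))}.
  by apply: continuous_comp; [exact: cc|apply: cf; exists x].
have n1 : \forall y \near x, f (cinv (mchart i) (cmap (mchart i) y)) = f y.
  have : \forall y \near x, cdom (mchart i) y by exact: open_nbhs_nbhs.
  by apply: filterS => y iy; rewrite iK.
move: c1; rewrite /prop_for /continuous_at /= iK //.
by apply: cvg_trans; apply: near_eq_cvg; apply: filterS n1 => y /= ->.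
Qed.

Lemma N_act_coord (a b1 b2 f : R) (x : orbX R) :
  set_val (orbit_act (N_incl (nN a (b1 +i* b2)%C f)) x) =
  G_coad a b1 b2 0 0 (set_val x).
Proof. by rewrite orbit_actE N_inclE coadG. Qed.

Lemma nN_caseR (g : NN R) : exists a b1 b2 f, g = nN a (b1 +i* b2)%C f.
Proof. by have [a [[b1 b2] [f ->]]] := nN_case g; do 4 eexists. Qed.

Lemma G_coad_mul (a b1 b2 a' b1' b2' : R) (m : 'rV[R]_6) :
  G_coad (a + a') (b1 + (cos (2 * pi * a) * b1' - sin (2 * pi * a) * b2'))
    (b2 + (cos (2 * pi * a) * b2' + sin (2 * pi * a) * b1')) 0 0 m =
  G_coad a b1 b2 0 0 (G_coad a' b1' b2' 0 0 m).
Proof.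
rewrite /G_coad; apply/rowP => k; rewrite !mxE !inordK //= (mulrDr (2 * pi) a) cosD sinD.
have := cos2Dsin2 (2 * pi * a).
set C := cos (2 * pi * a); set S := sin (2 * pi * a).
set C' := cos (2 * pi * a'); set S' := sin (2 * pi * a') => CS.
case: k => [[|[|[|[|[|[|k]]]]]] hk] //=; try ring.
set m1 := e6 m 1; set m2 := e6 m 2.
(* The inner b' and the inner momentum are both rotated by a; their cross product only acquires the
   factor C^2 + S^2, which is 1. *)
rewrite (_ : (b1 + (C * b1' - S * b2')) * ((C * C' - S * S') * m2 + (S * C' + C * S') * m1)
  - (b2 + (C * b2' + S * b1')) * ((C * C' - S * S') * m1 - (S * C' + C * S') * m2)
  = b1 * ((C * C' - S * S') * m2 + (S * C' + C * S') * m1)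
  - b2 * ((C * C' - S * S') * m1 - (S * C' + C * S') * m2)
  + (C ^+ 2 + S ^+ 2) * (b1' * (C' * m2 + S' * m1) - b2' * (C' * m1 - S' * m2))); last by ring.
rewrite CS; ring.
Qed.

Lemma orbit_act_continuous (g : GG R) : continuous (@orbit_act R (GG R) (orbX R) g).
Proof.
have [a [[b1 b2] [c [e [f ->]]]]] := gG_case g.
move=> x; apply: continuous_set_val.
rewrite (_ : (fun y => _) = (G_coad a b1 b2 c e) \o (set_val : orbX R -> 'rV[R]_6)).
  apply: continuous_comp; first exact: set_val_continuous.
  apply: (@smooth_continuous R _ _ setT) => //.
  apply: smooth_row; first exact: openT.
  by do 6 (case => [_|]; [rewrite /=; smooth_tac|]).
by apply/funext => y; rewrite /= [LHS]orbit_actE coadG.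
Qed.

Lemma N_action_smooth :
  @smooth R (prod_mfd (NN R) X) X (fun z => orbit_act (N_incl z.1) z.2).
Proof.
have [_ _ Xch Xcov _] := orbX_manifold R.
have Pch (i : mindex (prod_mfd (NN R) X)) : is_chart (@mchart R (prod_mfd (NN R) X) i).
  by apply: prod_is_chart; [exact: N_is_chart|exact: Xch].
have Psm (i : mindex (prod_mfd (NN R) X)) :
    smooth_on (cimg (@mchart R (prod_mfd (NN R) X) i)) (fun y =>
    set_val (orbit_act (N_incl (cinv (mchart i) y).1) (cinv (mchart i) y).2) : 'rV[R]_6).
  have [_ oi _ _ _] := Pch i.
  case: i oi => [[] [c hc]] oi.
  pose l (v : 'rV[R]_(4 + 4)) k := lsubmx v 0 (inord k) : R.
  pose r (v : 'rV[R]_(4 + 4)) := orb_incl c (rsubmx v).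
  have rsm k : smooth_on (cimg (prod_chart (@N_chart R) c)) (fun v => r v 0 k).
    apply: smooth_entry => // n.
    have [[_ oc _ _ _] _ _] := hc.
    apply: (Ck_on_comp oi oc _ _ (incl_smooth hc n)).
      by move=> _ [z [_ cz] <-] /=; rewrite row_mxKr; exists z.2.
    apply: Ck_on_mx => // a b; exact: smooth_rsub.
  apply: (@eq_smooth _ _ _ _ (fun v => G_coad (l v 0%N) (l v 1%N) (l v 2%N) 0 0 (r v))) => //.
    by move=> v _; rewrite -[RHS]/(set_val (orbit_act (N_incl
      (cinv (@N_chart R) (lsubmx v))) (cinv c (rsubmx v)))) cinvN N_act_coord.
  apply: smooth_row => //.
  by do 6 (case => [_|]; [rewrite /=; repeat first [exact: rsm | assumption
    | exact: smooth_cst | apply: smooth_add | apply: smooth_opp | apply: smooth_mul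
    | apply: smooth_sin | apply: smooth_cos | apply: smooth_lsub]|]).
apply: smooth_to_sub_mfd => //.
apply: chart_continuous => // [[n x]|i y iy].
  by have [j jx] := Xcov x; exists (tt, j).
by apply: continuous_set_val; exact: smooth_continuous (Psm i) iy.
Qed.

Lemma N_act_pullback (w : form2 X) (g : NN R) : is_KKS w ->
  is_pullback (fun x : X => orbit_act (N_incl g) x : X) w w.
Proof.
move=> wK [c hc] [c' hc'] x cx cx' u v.
have [chc _ _] := hc.
rewrite (KKS_formE hc' _ _ wK cx') (KKS_formE hc _ _ wK cx).
have [a [b1 [b2 [f gE]]]] := nN_caseR g.
have E z : 'd (orb_incl c') (cmap c' (orbit_act (N_incl g) x))
    (tmap (fun x : X => orbit_act (N_incl g) x : X) (exist _ c hc : mindex X)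
       (exist _ c' hc' : mindex X) x z)
    = G_coad a b1 b2 0 0 ('d (orb_incl c) (cmap c x) z).
  apply: (@tmap_incl R X _ (exist _ c hc) (exist _ c' hc') x) => //.
    exact: orbit_act_continuous.
  rewrite (_ : (fun y => _) = fun y => G_coad a b1 b2 0 0 (orb_incl c y)); last first.
    by apply/funext => y; rewrite gE [LHS]N_act_coord.
  have H k := has_diff_entry 0 (@inord 5 k) (incl_has_diff hc z cx).
  apply: has_diff_row.
  by do 6 (case => [_|]; [rewrite /=; eapply has_diff_eq;
    [repeat first [exact: H | exact: has_diff_cst | apply: has_diffD | apply: has_diffN
      | apply: has_diffM]
    | cbv beta; ring] |]).
have tu := incl_tangent hc u cx; have tv := incl_tangent hc v cx.
have ax : set_val (orbit_act (N_incl g) x : orbX R) = G_coad a b1 b2 0 0 (set_val x).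
  by rewrite gE N_act_coord.
rewrite ax.
transitivity (orb_form (G_coad a b1 b2 0 0 (set_val x))
  (G_coad a b1 b2 0 0 ('d (orb_incl c) (cmap c x) u))
  (G_coad a b1 b2 0 0 ('d (orb_incl c) (cmap c x) v))).
  exact: (f_equal2 (orb_form (G_coad a b1 b2 0 0 (set_val x))) (E u) (E v)).
exact: (orb_form_coad a b1 b2 (set_valP (x : orbX R)) tu tv).
Qed.

Lemma pairing_restr (m : 'rV[R]_6) (xi : 'rV[R]_4) :
  pairing (lie_restr (@N_incl R) m) xi = e6 m 0 * xi 0 (inord 0) +
   e6 m 1 * xi 0 (inord 1) + e6 m 2 * xi 0 (inord 2) + e6 m 5 * xi 0 (inord 3).
Proof.
rewrite lie_restrE pairing_sum sum_inord !big_nat_recr //= big_geq // add0r.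
by rewrite /G_restr !mxE !inordK.
Qed.

Lemma N_moment_map (w : form2 X) : is_KKS w -> is_moment_map (X_ham w).
Proof.
move=> wK; have [_ _ Xch Xcov _] := orbX_manifold R.
have momE : (fun x : orbX R => lie_restr (@N_incl R) (set_val x)) =
    G_restr (R:=R) \o (set_val : orbX R -> 'rV[R]_6).
  by apply/funext => x; rewrite lie_restrE.
have Gsm : smooth_on setT (@G_restr R).
  apply: smooth_row; first exact: openT.
  by do 4 (case => [_|]; [rewrite /=; smooth_tac|]).
split; first split.
- move=> x; rewrite /X_ham /orbit_ham /= momE.
  apply: continuous_comp; first exact: set_val_continuous.
  exact: smooth_continuous Gsm _.
- move=> [c hc] []; have [chc _ _] := hc.
  rewrite /X_ham /orbit_ham /= momE => k.
  have [_ oi _ _ _] := chc.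
  apply: (@sub_Ck_on _ _ _ _ _ (cimg c)); first by move=> _ [z [cz _] <-]; exists z.
  exact: (Ck_on_comp oi openT (fun _ _ => I) (incl_smooth hc k) (Gsm k)).
- move=> [c hc] x cx xi v.
  (* A fundamental field of [N] is that of the lifted vector [N_lift xi], whose c- and e-entries are
     0; pairing with it is the same as restricting and pairing with [xi]. *)
  rewrite [LHS](KKS_formE hc _ _ wK cx) [X in orb_form _ X _]incl_fund_vecN //.
  rewrite orb_form_ad_star; [|exact: set_valP (x : orbX R)|exact: incl_tangent].
  congr (- _); rewrite pairing6 /N_lift !mxE !inordK //=.
  have H k := has_diff_entry 0 (@inord 5 k) (incl_has_diff hc v cx).
  set d := 'd (orb_incl c) (cmap c x) v in H *.
  have [_ <-] : has_diff (fun y => e6 (orb_incl c y) 0 * xi 0 (inord 0) +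
     e6 (orb_incl c y) 1 * xi 0 (inord 1) + e6 (orb_incl c y) 2 * xi 0 (inord 2)
     + e6 (orb_incl c y) 5 * xi 0 (inord 3)) (cmap c x) v
     (e6 d 0 * xi 0 (inord 0) + e6 d 1 * xi 0 (inord 1) + e6 d 2 * xi 0 (inord 2)
      + e6 d 3 * 0 + e6 d 4 * 0 + e6 d 5 * xi 0 (inord 3)).
    eapply has_diff_eq.
      repeat first [exact: H|exact: has_diff_cst|apply: has_diffD|apply: has_diffM].
    cbv beta; ring.
  apply: (f_equal (fun F : 'rV[R]_4 -> R => 'd F (cmap c x) v)).
  by apply/funext => y; rewrite [RHS]pairing_restr.
Qed.

Lemma restr_coad (a b1 b2 : R) (m : 'rV[R]_6) :
  G_restr (G_coad a b1 b2 0 0 m) = N_coad a b1 b2 (G_restr m).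
Proof.
apply/rowP => k; rewrite /G_restr /G_coad /N_coad !mxE !inordK //=.
by case: k => [[|[|[|[|k]]]] hk] //=; ring.
Qed.

Lemma X_hamiltonian (w : form2 X) : is_KKS w -> is_hamiltonian (X_ham w).
Proof.
move=> wK; split.
- by split; [exact: orbX_manifold|exact: KKS_symplectic].
- split.
  + have E1 : N_incl (lg_one (NN R)) = lg_one (GG R) by exact: val_inj.
    move=> x; exact: (eq_trans (congr1 (fun g => @orbit_act R (GG R) _ g x) E1) (orbit_act1 x)).
  + move=> g h x; apply: val_inj.
    have [a [b1 [b2 [f ->]]]] := nN_caseR g.
    have [a' [b1' [b2' [f' ->]]]] := nN_caseR h.
    rewrite nN_mul expj_complex [LHS]N_act_coord [RHS]N_act_coord N_act_coord.
    exact: G_coad_mul.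
  + exact: N_action_smooth.
- by move=> g; exact: N_act_pullback.
- exact: N_moment_map.
- move=> g x; have [a [b1 [b2 [f ->]]]] := nN_caseR g.
  rewrite coadN /X_ham /orbit_ham /=.
  by rewrite !lie_restrE N_act_coord restr_coad.
Qed.

Lemma N_coad_ndual (a b1 b2 p q : R) :
  N_coad a b1 b2 (ndual p (expj q) 1) =
  ndual (p + 2 * pi * (b1 * sin (2 * pi * (q + a)) - b2 * cos (2 * pi * (q + a))))
    (expj (q + a)) (1 : R).
Proof.
rewrite /N_coad /ndual; apply/rowP => k.
rewrite !mxE !inordK //= !(mulrDr (2 * pi) q a) !cosD !sinD.
by case: k => [[|[|[|[|k]]]] hk] //=; ring.
Qed.

Lemma restr_gdual p z r s t : @G_restr R (gdual p z r s t) = ndual p z t.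
Proof.
by apply/rowP => k; rewrite /G_restr /gdual /ndual !mxE !inordK.
Qed.

Lemma X_primary (w : form2 X) : is_primary (X_ham w) (orbU R).
Proof.
split.
  exists (ndual 0 (expj 0) 1); apply/seteqP; split.
    move=> _ [p _ [q _ <-]].
    have pi0 := two_pi_neq0 R.
    (* The element a = q gives the angle, and b along (sin, - cos) makes the angular term of
       [N_coad_ndual] equal to p. *)
    exists (nN q (p * sin (2 * pi * q) / (2 * pi) +i*
      - (p * cos (2 * pi * q) / (2 * pi)))%C 0) => //.
    rewrite coadN N_coad_ndual !add0r; congr ndual.
    transitivity (p * (cos (2 * pi * q) ^+ 2 + sin (2 * pi * q) ^+ 2)).
      move: (cos (2 * pi * q)) (sin (2 * pi * q)) => C S.
      by move: (2 * pi) pi0 => T T0; field.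
    by rewrite cos2Dsin2 mulr1.
  move=> _ [g _ <-]; have [a [b1 [b2 [f ->]]]] := nN_caseR g.
  rewrite coadN N_coad_ndual; by do 2 eexists => //.
apply/seteqP; split.
  move=> _ [x _ <-] /=; rewrite lie_restrE.
  have := set_valP (x : orbX R); rewrite {1}orbXE => -[p [q [r [s E]]]].
  by exists p => //; exists q => //; rewrite -(restr_gdual p _ r s) -E.
move=> _ [p _ [q _ <-]].
have Xm : orbX R (gdual p (expj q) 0 0 1) by rewrite orbXE; exists p, q, 0, 0.
exists (SigSub (mem_set Xm) : orbX R) => //=.
by rewrite lie_restrE restr_gdual.
Qed.

End Hamiltonian.

(** * X does not split *)

Section NonSplitting.
Variable R : realType.

(** The set where [h] takes the value [h 0] is open and closed in the connected line. *)
Lemma locally_constant_constant (T : Type) (h : R -> T) :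
  (forall q, \forall q' \near q, h q' = h q) -> forall q, h q = h 0.
Proof.
move=> hl; have cT : connected [set: R] by apply/connected_intervalP.
have E : [set q | h q = h 0] = setT.
  apply: cT; first by exists 0.
  - exists [set q | h q = h 0]; last by rewrite setTI.
    apply: open_nearP => q /= hq.
    by apply: filterS (hl q) => q' /= ->.
  - exists [set q | h q = h 0]; last by rewrite setTI.
    rewrite -openC; apply: open_nearP => q /= hq.
    by apply: filterS (hl q) => q' /= E; rewrite /setC /= E.
by move=> q; have : [set q | h q = h 0] q by rewrite E.
Qed.

(** A curve within one fibre stays, for nearby parameters, in the same open sheet, on which [f] is
    injective; it is therefore locally constant. *)
Lemma covering_lift_constant (T : topologicalType) d (f : T -> 'rV[R]_d) (U : set 'rV[R]_d)
    (u : 'rV[R]_d) (h : R -> T) :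
  is_covering f U -> U u -> continuous h -> (forall q, f (h q) = u) ->
  forall q, h q = h 0.
Proof.
move=> [_ _ cov] Uu ch fh; apply: locally_constant_constant => q.
have [V [K [S [[_ Vu] VS _ HS]]]] := cov _ Uu.
have : (f @^-1` V) (h q) by rewrite /= fh.
rewrite VS => -[k _ Skq]; have [oS inj _ _] := HS k.
have : \forall q' \near q, S k (h q') by apply: near_continuous => //; exact: ch.
by apply: filterS => q' Skq'; apply: inj; rewrite ?inE ?fh.
Qed.


(** The stabilizer in [N] of a point of [U] has one component for each integer a; a = 1 lies outside
    the identity component. *)
Lemma expj1 : expj (1 : R) = expj 0.
Proof.
by rewrite expj0 /expj mulr1 mulr_natl cos2pi sin2pi.
Qed.

Lemma fibre_line_orbX (s : R) : orbX R (gdual 0 (expj 0) 0 s 1).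
Proof. by rewrite orbXE; exists 0, 0, 0, s. Qed.

(* A curve in X projecting to one point of U; its end points s = 0 and s = 1
   lie on one N-orbit. *)
Definition fibre_line (s : R) : orbX R := SigSub (mem_set (fibre_line_orbX s)).

Lemma fibre_line_continuous : continuous fibre_line.
Proof.
move=> s; apply: continuous_set_val.
apply: (@smooth_continuous R R 'rV[R]_6 setT) => //.
apply: smooth_row; first exact: openT.
by do 6 (case => [_|]; [rewrite /=; repeat first [exact: openT | exact: smooth_cst
  | exact: smooth_id | apply: smooth_opp]|]).
Qed.

Lemma fibre_line_act :
  orbit_act (N_incl (nN 1 (0 +i* 0)%C 0)) (fibre_line 0) = fibre_line 1.
Proof.
apply: val_inj; rewrite [LHS]N_act_coord [LHS]G_coad_gdual.
rewrite !mul0r subr0 mulr0 !addr0 add0r expj1 subr0.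
by [].
Qed.

Lemma X_not_splits (w : form2 (sub_mfd 4 (orbX R))) : ~ splits (X_ham w) (orbU R).
Proof.
move=> [Ub [T [w' [_ cov _ [f [f' [[fK _] [[cf _] _] fact _ fmom]]]]]]].
pose h (s : R) : Ub := (f (fibre_line s)).1.
have ch : continuous h.
  move=> s; apply: (@continuous_comp _ _ _ fibre_line (fun x => (f x).1)).
    exact: fibre_line_continuous.
  apply: continuous_comp; first exact: cf.
  exact: cvg_fst.
(* The factor [T] has moment 0, so the moment of the first component alone is that of the point of
   [X]. *)
have hmom s : hs_mom (h s) = ndual 0 (expj 0) 1.
  have := fmom (fibre_line s); rewrite /= addr0 lie_restrE => ->.
  exact: restr_gdual.
have Uu : orbU R (ndual 0 (expj 0) 1) by exists 0 => //; exists 0.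
have h1 : h 1 = h 0 := covering_lift_constant cov Uu ch hmom 1.
have f10 : f (fibre_line 1) = f (fibre_line 0).
  have E := fact (nN 1 (0 +i* 0)%C 0) (fibre_line 0).
  have E' : f (fibre_line 1) = (hs_act (nN 1 (0 +i* 0)%C 0) (f (fibre_line 0)).1,
      (f (fibre_line 0)).2) by rewrite -fibre_line_act; exact: E.
  have : (f (fibre_line 1)).2 = (f (fibre_line 0)).2 by rewrite E'.
  by move: h1; rewrite /h; case: (f _) => a b; case: (f _) => a' b' /= -> ->.
(* Coordinate 4 is - s, and it separates the two end points of the line. *)
have := congr1 (fun x : orbX R => (set_val x : 'rV[R]_6) 0 (inord 4)) (can_inj fK f10).
rewrite /= /gdual !mxE !inordK //= oppr0 => /eqP; rewrite oppr_eq0 oner_eq0.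
by [].
Qed.

End NonSplitting.

Theorem mainTheorem6 (R : realType) :
  [/\ is_lie_group (GG R) /\ solvable_group (GG R),
      is_lie_group (NN R) /\ is_normal_subgroup (range (@N_incl R)),
      orbX R = [set nu | exists p q r s : R, nu = gdual p (expj q) r s 1],
      (forall (g : GG R) (x : orbX R),
         set_val (orbit_act g x) = coad g (set_val x))
    & (exists w : form2 (sub_mfd 4 (orbX R)), is_KKS w) /\
      (forall w : form2 (sub_mfd 4 (orbX R)), is_KKS w ->
        [/\ is_hamiltonian (X_ham w),
            is_primary (X_ham w) (orbU R),
            ~ splits (X_ham w) (orbU R)
          & ~ splits_trivially (X_ham w) (orbU R) /\
            ~ splits_nontrivially (X_ham w) (orbU R)])].
Proof.
split.
- by split; [exact: G_lie_group|exact: G_solvable].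
- by split; [exact: N_lie_group|exact: N_normal].
- exact: orbXE.
- exact: orbit_actE.
split; first by exists (@orb_form2 R); exact: orb_form2_KKS.
move=> w wK; have ns := X_not_splits (w := w).
split; [exact: X_hamiltonian|exact: X_primary|exact: ns|split].
  by move=> [Ub [T [w' [H _]]]]; apply: ns; exists Ub, T, w'.
by move=> [Ub [T [w' [H _]]]]; apply: ns; exists Ub, T, w'.
Qed.
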